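(* $\rho\tau(K_{13}, o(\mathbf{Q}(5,n))) \le 4/15$. That is, for every $\gamma>0$ there is $\delta>0$ such that every $n$-vertex $K_{13}$-free graph $G$ with $\alpha(G)\le \delta\,\mathbf{Q}(5,n)$ satisfies $e(G)\le (4/15+\gamma)n^2$ for all sufficiently large $n$.
   Context: For a graph $H$ and a function $f(n)$, the Ramsey–Turán number $\mathbf{RT}(n,H,f(n))$ is the maximum number of edges in an $n$-vertex $H$-free graph with independence number at most $f(n)$. Let $\overline{\rho\tau}(H,f)=\limsup_{n\to\infty}\mathbf{RT}(n,H,f(n))/n^2$ and $\underline{\rho\tau}(H,f)=\liminf_{n\to\infty}\mathbf{RT}(n,H,f(n))/n^2$; when they coincide, their common value is $\rho\tau(H,f)$. Further $\rho\tau(H,o(f)) := \lim_{\delta\to 0}\rho\tau(H,\delta f)$; an upper bound $\rho\tau(H,o(f))\le c$ means $\lim_{\delta\to0}\overline{\rho\tau}(H,\delta f)\le c$. The inverse Ramsey number $\mathbf{Q}(t,n)$ is the minimum independence number of a $K_t$-free graph on $n$ vertices. *)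

(* Defs.v *)
From mathcomp Require Import all_boot all_order all_algebra.
From mathcomp Require Import all_classical all_reals all_analysis.

Set Implicit Arguments.
Unset Strict Implicit.
Unset Printing Implicit Defensive.

Import Order.TTheory GRing.Theory Num.Theory.
Import numFieldNormedType.Exports.

Local Open Scope classical_set_scope.
Local Open Scope ring_scope.

(* A simple graph on V is its set of edges, each edge being a 2-element subset
   of V.  For a finType V this is again a finType, so that extrema over all
   graphs on V are finite big operators. *)
Definition sgraph (V : finType) : Type :=
  {E : {set {set V}} | [forall e in E, #|e| == 2]}.

Definition edges (V : finType) (G : sgraph V) : {set {set V}} := sval G.

Definition num_edges (V : finType) (G : sgraph V) : nat := #|edges G|.

Definition independent (V : finType) (G : sgraph V) (S : {set V}) : bool :=
  [forall e in edges G, ~~ (e \subset S)].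

Definition indep_number (V : finType) (G : sgraph V) : nat :=
  \max_(S : {set V} | independent G S) #|S|.

(* H is a (not necessarily induced) subgraph of G, up to renaming vertices. *)
Definition has_copy (W V : finType) (H : sgraph W) (G : sgraph V) : bool :=
  [exists f : {ffun W -> V},
    injectiveb f && [forall e in edges H, (f @: e)%SET \in edges G]].

Definition is_free (W V : finType) (H : sgraph W) (G : sgraph V) : bool :=
  ~~ has_copy H G.

Lemma complete_edges_subproof (t : nat) :
  [forall e in [set e : {set 'I_t} | #|e| == 2]%SET, #|e| == 2].
Proof. by apply/forall_inP => e; rewrite inE. Qed.

Definition complete (t : nat) : sgraph 'I_t :=
  exist _ [set e : {set 'I_t} | #|e| == 2]%SET (complete_edges_subproof t).

(* RT(n, H, a).  The value is 0 if no graph satisfies the constraints. *)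
Definition RT (R : realType) (W : finType) (H : sgraph W) (n : nat) (a : R)
    : nat :=
  \max_(G : sgraph 'I_n | is_free H G && ((indep_number G)%:R <= a))
    num_edges G.

(* Q(t, n).  Independence numbers are at most n and, for t >= 2, the edgeless
   graph is K_t-free with independence number n, so the default value n of the
   big operator does not alter the minimum. *)
Definition inv_ramsey (t n : nat) : nat :=
  \big[minn/n]_(G : sgraph 'I_n | is_free (complete t) G) indep_number G.

Definition upper_rho_tau (R : realType) (W : finType) (H : sgraph W)
    (f : nat -> R) : \bar R :=
  limn_esup (fun n : nat => ((RT H n (f n))%:R / n%:R ^+ 2)%:E).

(* rho_tau(H, o(f)) <= c.  The limit is taken over delta > 0. *)
Definition rho_tau_o_le (R : realType) (W : finType) (H : sgraph W)
    (f : nat -> R) (c : R) : Prop :=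
  exists2 l : \bar R,
    upper_rho_tau H (fun n : nat => delta * f n) @[delta --> 0^'+] --> l
    & (l <= c%:E)%E.

(* Main.v *)
Require Import Defs.
From mathcomp Require Import all_boot all_order all_algebra.
From mathcomp Require Import all_classical all_reals all_analysis.
From mathcomp Require Import ssrbool eqtype ssrnat seq fintype bigop finset archimedean ring lra zify.

(** Szemeredi's regularity lemma is not needed.  If the independence number is
    at most [delta * Q(5, n)], every set of linear size contains a [K_5]; since
    a random graph shows [Q(5, n) <= n^(9/20)] up to a constant, every set of
    size about [n^(9/10)] contains a triangle.  Dependent random choice turns a
    lower-regular family [A_i] over [D] into linear subsets of the [A_i] in which
    every clique on at most 11 vertices extends by a triangle of [D].  Hence four
    pairwise lower-regular sets contain a clique of size 5 + 3 + 3 + 3, and three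
    of them, one pair having density above 4/5, a clique of size 5 + 5 + 3.
    If all degrees exceed (8/15) n, a lower-regular pair exists; the densities of
    an average vertex to its two sides sum to more than 1, which produces a
    lower-regular triple; the densities of an average vertex to its three sides
    sum to more than 8/5, which produces one of the two configurations above. *)

Set Implicit Arguments.
Unset Strict Implicit.
Unset Printing Implicit Defensive.

Import Order.TTheory GRing.Theory Num.Theory.
Import numFieldNormedType.Exports.

Local Open Scope ring_scope.

(** * Lower-regular pairs *)

(** The bound decomposes as 4/15 = (1/2) (1/3) (8/5). The degree sum is twice the number of edges,
    which gives 8/15; three sets give the factor 3; and 8/5 is twice 4/5, the density beyond which
    any five vertices still have a linear common neighbourhood. If one of the three densities is
    negligible, the other two sum to more than 8/5, so one of them passes 4/5. What matters about
    the exponent 9/20 is that it is below 1/2: by the square-root bound for triangles, triangles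
    then occur in sets polynomially smaller than n, and such a gap is exactly what a bounded number
    of picks in dependent random choice can exploit. 5-cliques are guaranteed only in sets of linear
    size, so they are taken first, while sizes are controlled, and triangles finish each clique.
    Only lower bounds on the densities of subpairs are used, and a density increment yields these
    one pair at a time with linear sizes. *)

Lemma subset_of_average (R : realFieldType) (V : finType) (f : V -> R) (c : R)
    (s : nat) (A : {set V}) :
  (s <= #|A|)%N -> c * #|A|%:R <= \sum_(x in A) f x ->
  exists A1 : {set V}, [/\ A1 \subset A, #|A1| = s & c * s%:R <= \sum_(x in A1) f x].
Proof.
move: {2}(#|A| - s)%N (erefl (#|A| - s)%N) => k.
elim: k A => [|k IHk] A Ek le_sA le_cA.
  have EA : #|A| = s by lia.
  by exists A; split=> //; rewrite -EA.
have A_gt0 : (0 < #|A|)%N by lia.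
(* Some element has at most the average value; deleting it keeps the average at least [c]. *)
have [x xA Hx] : exists2 x, x \in A & c * (#|A|%:R - 1) <= \sum_(y in A) f y - f x.
  apply/exists_inP; rewrite -[X in is_true X]negbK negb_exists_in; apply/negP.
  move=> /forall_inP all_lt.
  have [x0 x0A] : exists x, x \in A by apply/set0Pn; rewrite -card_gt0.
  have : \sum_(x in A) (\sum_(y in A) f y - f x) < \sum_(x in A) c * (#|A|%:R - 1).
    apply: ltr_sum => [|x xA]; last by rewrite ltNge all_lt.
    by apply/hasP; exists x0; rewrite ?mem_index_enum.
  rewrite sumrB !sumr_const -[(\sum_(y in A) f y) *+ _]mulr_natr -[(c * _) *+ _]mulr_natr.
  move: (\sum_(x in A) f x) le_cA => S le_cA lt_S.
  have : 0 <= (#|A|%:R - 1) * (S - c * #|A|%:R).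
    by rewrite mulr_ge0 ?subr_ge0 ?ler1n.
  move: #|A|%:R le_cA lt_S => a; clear; lra.
have EA : #|A| = #|A :\ x|.+1 by rewrite (cardsD1 x) xA.
have [||| A1 [sA1 EA1 Hs]] := IHk (A :\ x); [lia | lia | | ].
  move: Hx; rewrite (big_setD1 x xA) /= EA -[X in _ * (X - 1)]natr1; lra.
by exists A1; split=> //; apply: subset_trans sA1 (subD1set _ _).
Qed.

Section Density.
Variables (R : archiRealFieldType) (V : finType) (e : rel V).
Implicit Types (A B C D S T X : {set V}) (p : R) (s : nat).

Definition nbr A x : {set V} := [set y in A | e x y].
Definition common_nbr A T : {set V} := [set y in A | [forall x in T, e x y]].
(** Ordered pairs: an edge inside both sets counts twice, so on the whole vertex set this is twice
    the number of edges. *)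
Definition ecount A B : nat := \sum_(x in A) #|nbr B x|.

(* The size threshold is absolute, so the property passes to subsets. *)
Definition lower_regular A B p s : Prop :=
  forall A1 B1, A1 \subset A -> B1 \subset B -> (s <= #|A1|)%N -> (s <= #|B1|)%N ->
  p * #|A1|%:R * #|B1|%:R <= (ecount A1 B1)%:R.

Lemma lower_regular_sub A B p s A1 B1 s1 :
  A1 \subset A -> B1 \subset B -> (s <= s1)%N ->
  lower_regular A B p s -> lower_regular A1 B1 p s1.
Proof.
move=> sA sB les H A2 B2 sA2 sB2 cA cB.
by apply: H; [exact: subset_trans sA | exact: subset_trans sB | lia | lia].
Qed.

Lemma lower_regular_le A B p p1 s :
  p1 <= p -> lower_regular A B p s -> lower_regular A B p1 s.
Proof.
move=> lep H A2 B2 sA2 sB2 cA cB; apply: le_trans (H _ _ sA2 sB2 cA cB).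
by rewrite -!mulrA ler_wpM2r // mulr_ge0.
Qed.

Lemma nbr_split B1 B x : B1 \subset B ->
  #|nbr B x| = (#|nbr B1 x| + #|nbr (B :\: B1) x|)%N.
Proof.
move=> sB; rewrite -(cardsID B1 (nbr B x)); congr (_ + _)%N; apply: eq_card => y.
  by rewrite !inE; case yB1: (y \in B1); rewrite ?andbF ?andbT // (subsetP sB).
by rewrite !inE andbA.
Qed.

Lemma ecount_split_l A1 A B : A1 \subset A ->
  ecount A B = (ecount A1 B + ecount (A :\: A1) B)%N.
Proof. by move=> sA; rewrite /ecount (big_setID A1) /= (setIidPr sA). Qed.

Lemma ecount_split_r A B1 B : B1 \subset B ->
  ecount A B = (ecount A B1 + ecount A (B :\: B1))%N.
Proof.
by move=> sB; rewrite /ecount -big_split; apply: eq_bigr => x _; exact: nbr_split.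
Qed.

Lemma ecount_le A B : (ecount A B <= #|A| * #|B|)%N.
Proof.
rewrite -sum_nat_const; apply: leq_sum => x _; apply: subset_leq_card.
by apply/subsetP => y; rewrite inE => /andP[].
Qed.

Hypothesis e_sym : symmetric e.

Lemma ecountC A B : ecount A B = ecount B A.
Proof.
rewrite /ecount.
under eq_bigr do rewrite -sum1_card big_mkcond /=.
rewrite exchange_big /= [RHS](eq_bigr (fun y => \sum_(x in A) e x y)%N); last first.
  move=> y _; rewrite -sum1_card big_mkcond [RHS]big_mkcond /=.
  by apply: eq_bigr => x _; rewrite inE e_sym; case: (x \in A); case: (e _ _).
rewrite [RHS]big_mkcond; apply: eq_bigr => y _.
case yB: (y \in B); last by rewrite big1 // => x _; rewrite inE yB.
by apply: eq_bigr => x _; rewrite inE yB; case: (e _ _).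
Qed.

Lemma lower_regularC A B p s : lower_regular A B p s -> lower_regular B A p s.
Proof.
by move=> H B1 A1 sB sA cB cA; rewrite ecountC mulrAC; apply: H.
Qed.

(** Averaging over one side and then over the other loses no density, so a pair can be cut to
    prescribed sizes. *)
Lemma ecount_trim A B p s : (s <= #|A|)%N -> (s <= #|B|)%N ->
  p * #|A|%:R * #|B|%:R <= (ecount A B)%:R ->
  exists A1 B1, [/\ A1 \subset A, B1 \subset B, #|A1| = s, #|B1| = s &
    p * s%:R * s%:R <= (ecount A1 B1)%:R].
Proof.
move=> leA leB; rewrite mulrAC /ecount natr_sum.
move=> /(subset_of_average leA)[A1 [sA1 EA1]]; rewrite -natr_sum -/(ecount A1 B).
rewrite ecountC mulrAC /ecount natr_sum.
move=> /(subset_of_average leB)[B1 [sB1 EB1]]; rewrite -natr_sum -/(ecount B1 A1).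
by rewrite ecountC; exists A1, B1.
Qed.

Lemma ecount_trim_low A B p s : (s <= #|A|)%N -> (s <= #|B|)%N ->
  (ecount A B)%:R <= p * #|A|%:R * #|B|%:R ->
  exists A1 B1, [/\ A1 \subset A, B1 \subset B, #|A1| = s, #|B1| = s &
    (ecount A1 B1)%:R <= p * s%:R * s%:R].
Proof.
move=> leA leB; rewrite -lerN2 mulrAC -mulNr /ecount natr_sum -sumrN.
move=> /(subset_of_average leA)[A1 [sA1 EA1]]; rewrite sumrN -natr_sum -/(ecount A1 B).
rewrite ecountC mulNr mulrAC -!mulNr /ecount natr_sum -sumrN.
move=> /(subset_of_average leB)[B1 [sB1 EB1]]; rewrite sumrN -natr_sum -/(ecount B1 A1).
by rewrite ecountC !mulNr lerN2; exists A1, B1.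
Qed.

(* Density increment: a sparse pair of subsets forces a pair of density larger
   by [beta / L ^ 2] among the remaining three pairs, so after [k] steps the
   density would exceed 1. *)
Lemma regular_pair_iter (beta : R) (L : nat) : 0 < beta -> (1 < L)%N ->
  forall (k s : nat) A B p, (0 < s)%N -> 1 < p + k%:R * (beta / L%:R ^+ 2) ->
  (L ^ k * s <= #|A|)%N -> (L ^ k * s <= #|B|)%N ->
  p * #|A|%:R * #|B|%:R <= (ecount A B)%:R ->
  exists s' A' B', [/\ (s <= s')%N, (s' <= L ^ k * s)%N, A' \subset A, B' \subset B &
    [/\ #|A'| = (L * s')%N, #|B'| = (L * s')%N & lower_regular A' B' (p - beta) s']].
Proof.
move=> beta0 L1; elim=> [|k IHk] s A B p s0 p1 cA cB dAB.
  exfalso; move: dAB; rewrite leNgt => /negP; apply.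
  have A0 : (0 < #|A|)%N by lia.
  have B0 : (0 < #|B|)%N by lia.
  apply: le_lt_trans (_ : (#|A| * #|B|)%:R < _).
    by rewrite ler_nat ecount_le.
  rewrite natrM -mulrA ltr_pMl ?mulr_gt0 ?ltr0n //; lra.
have L0 : 0 < L%:R :> R by rewrite ltr0n; lia.
have sN : (s <= L ^ k * s)%N by rewrite leq_pmull // expn_gt0; lia.
have {}IHk := IHk s.
move: cA cB; rewrite expnS -mulnA.
move: (L ^ k * s)%N IHk sN => N IHk sN cA cB.
have N0 : (0 < N)%N by lia.
(* Both sides are cut to exactly [L * N], so a sparse pair with sides [N] fills the fraction
   [1 / L ^ 2] of the whole; this is the source of the increment. *)
have [A1 [B1 [sA1 sB1 cA1 cB1 d1]]] := ecount_trim cA cB dAB.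
have LN : (2 * N <= L * N)%N by rewrite leq_mul2r; lia.
have [low|reg] : (exists A2 B2, [/\ A2 \subset A1, B2 \subset B1, #|A2| = N, #|B2| = N &
    (ecount A2 B2)%:R <= (p - beta) * N%:R * N%:R]) \/ lower_regular A1 B1 (p - beta) N.
- have [|none] := boolP [exists A2 : {set V}, [exists B2 : {set V},
    [&& A2 \subset A1, B2 \subset B1, (N <= #|A2|)%N, (N <= #|B2|)%N &
      (ecount A2 B2)%:R < (p - beta) * #|A2|%:R * #|B2|%:R]]].
    move=> /existsP[A2 /existsP[B2 /and5P[sA2 sB2 cA2 cB2 /ltW]]].
    move=> /(ecount_trim_low cA2 cB2)[A3 [B3 [sA3 sB3 cA3 cB3 d3]]]; left.
    exists A3, B3; split=> //; [exact: subset_trans sA2 | exact: subset_trans sB2].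
  right=> A2 B2 sA2 sB2 cA2 cB2; rewrite leNgt; apply: contra none => lt.
  by apply/existsP; exists A2; apply/existsP; exists B2; apply/and5P.
- have [A2 [B2 [sA2 sB2 cA2 cB2 d2]]] := low.
  set th := beta / L%:R ^+ 2 in p1 *.
  have th0 : 0 < th by rewrite divr_gt0 ?exprn_gt0.
  have [A3 [B3 [sA3 sB3 cA3 cB3 d3]]] : exists A3 B3, [/\ A3 \subset A1, B3 \subset B1,
      (N <= #|A3|)%N, (N <= #|B3|)%N & (p + th) * #|A3|%:R * #|B3|%:R <= (ecount A3 B3)%:R].
    have LN1 : (N <= L * N - N)%N by clear -LN; lia.
    have cA' : #|A1 :\: A2| = (L * N - N)%N by rewrite cardsD (setIidPr sA2) cA1 cA2.
    have cB' : #|B1 :\: B2| = (L * N - N)%N by rewrite cardsD (setIidPr sB2) cB1 cB2.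
    have [?|h1] := lerP ((p + th) * #|A2|%:R * #|B1 :\: B2|%:R) (ecount A2 (B1 :\: B2))%:R.
      by exists A2, (B1 :\: B2); split=> //; rewrite ?subsetDl ?cA2 ?cB'.
    have [?|h2] := lerP ((p + th) * #|A1 :\: A2|%:R * #|B2|%:R) (ecount (A1 :\: A2) B2)%:R.
      by exists (A1 :\: A2), B2; split=> //; rewrite ?subsetDl ?cB2 ?cA'.
    have [?|h3] := lerP ((p + th) * #|A1 :\: A2|%:R * #|B1 :\: B2|%:R) (ecount (A1 :\: A2) (B1 :\: B2))%:R.
      by exists (A1 :\: A2), (B1 :\: B2); split=> //; rewrite ?subsetDl ?cA' ?cB'.
    (* With the three remaining pairs below [p + th], the total is below
       [p L^2 N^2 - beta N^2 + th (L^2 - 1) N^2], which is less than [p L^2 N^2] because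
       [beta = th L^2]. *)
    exfalso; move: d1 d2 h1 h2 h3.
    rewrite (ecount_split_l B1 sA2) !(ecount_split_r _ sB2) cA' cB' cA2 cB2.
    rewrite natrB; last by clear -LN1 N0; lia.
    rewrite !natrD natrM => d1 d2 h1 h2 h3.
    have Eb : beta = th * L%:R ^+ 2 by rewrite /th divfK // expf_neq0 // gt_eqF.
    have N0' : 0 < N%:R :> R by rewrite ltr0n.
    have : 0 < th * N%:R ^+ 2 by rewrite mulr_gt0 // exprn_gt0.
    move: d1 d2 h1 h2 h3; rewrite Eb; clear; lra.
  have [|s' [A4 [B4 [ss' s'N sA4 sB4 [cA4 cB4 reg]]]]] := IHk A3 B3 (p + th) s0 _ cA3 cB3 d3.
    by move: p1; rewrite -/th -[k.+1%:R]natr1 mulrDl mul1r; clear; lra.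
  exists s', A4, B4; split=> //.
  - by apply: leq_trans s'N _; clear -LN; lia.
  - exact: subset_trans (subset_trans sA4 sA3) sA1.
  - exact: subset_trans (subset_trans sB4 sB3) sB1.
  - by split=> //; apply: lower_regular_le reg; lra.
- exists N, A1, B1; split=> //; lia.
Qed.

End Density.

(** * Dependent random choice *)

(** The exponent is a number of increments [beta / L ^ 2] that carries any density above 1; each
    increment costs a factor [L] in size. *)
Definition regular_bound (R : archiRealFieldType) (beta : R) (L : nat) : nat :=
  L ^ Num.bound (L%:R ^+ 2 / beta).

Lemma regular_bound_gt0 (R : archiRealFieldType) (beta : R) (L : nat) :
  (0 < L)%N -> (0 < regular_bound beta L)%N.
Proof. by move=> L0; rewrite expn_gt0 L0. Qed.

Section Embedding.
Variables (R : archiRealFieldType) (V : finType) (e : rel V).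
Hypothesis e_sym : symmetric e.
Implicit Types (A B C D S T X W : {set V}) (p : R) (s : nat).

Lemma regular_pair (beta : R) (L s : nat) A B p :
  0 < beta -> (1 < L)%N -> (0 < s)%N -> 0 <= p ->
  (regular_bound beta L * s <= #|A|)%N -> (regular_bound beta L * s <= #|B|)%N ->
  p * #|A|%:R * #|B|%:R <= (ecount e A B)%:R ->
  exists s' A' B', [/\ (s <= s')%N, (s' <= regular_bound beta L * s)%N,
    A' \subset A, B' \subset B &
    [/\ #|A'| = (L * s')%N, #|B'| = (L * s')%N & lower_regular e A' B' (p - beta) s']].
Proof.
move=> beta0 L1 s0 p0; apply: regular_pair_iter => //.
have th0 : 0 < beta / L%:R ^+ 2 by rewrite divr_gt0 // exprn_gt0 // ltr0n; lia.
apply: lt_le_trans (_ : (Num.bound (L%:R ^+ 2 / beta))%:R * (beta / L%:R ^+ 2) <= _); last by lra.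
rewrite -ltr_pdivrMr // mul1r invf_div; apply: archi_boundP.
by rewrite ltW // -invf_div invr_gt0.
Qed.

(** Otherwise the low vertices and [A1] would form a pair of large subsets of density below [p]. *)
Lemma regular_few_low A D p s A1 : (0 < s)%N -> lower_regular e A D p s ->
  A1 \subset A -> (s <= #|A1|)%N ->
  (#|[set d in D | (#|nbr e A1 d|%:R < p * #|A1|%:R)%R]| < s)%N.
Proof.
move=> s0 reg sA cA; rewrite ltnNge; apply/negP => cB.
set B := [set d in D | _] in cB *.
have sB : B \subset D by apply/subsetP => d; rewrite inE => /andP[].
have := reg _ _ sA sB cA cB; rewrite leNgt => /negP; apply.
rewrite ecountC // /ecount natr_sum.
have -> : p * #|A1|%:R * #|B|%:R = \sum_(d in B) p * #|A1|%:R.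
  by rewrite sumr_const mulr_natr.
apply: ltr_sum => [|x]; last by rewrite inE => /andP[].
have /set0Pn[x xB] : B != set0 by rewrite -card_gt0; lia.
by apply/hasP; exists x; rewrite ?mem_index_enum.
Qed.

(* Dependent random choice, derandomised: the vertices of [D] are picked one at
   a time, each pick dividing the number of surviving bad sets [F i] by
   [#|D| / (2 m)] while the sets [A], [B], [C] shrink by a factor [eta]. *)
Lemma dependent_choice_iter (I : finType) (F : I -> {set V}) (eta : R) (D : {set V})
    (s m : nat) :
  0 <= eta <= 1 -> (0 < s)%N -> (6 * s <= #|D|)%N ->
  forall (q : nat) A B C (Z : {set I}),
  lower_regular e A D eta s -> lower_regular e B D eta s -> lower_regular e C D eta s ->
  s%:R <= eta ^+ q * #|A|%:R -> s%:R <= eta ^+ q * #|B|%:R -> s%:R <= eta ^+ q * #|C|%:R ->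
  (forall i, i \in Z -> (#|common_nbr e D (F i)| <= m)%N) ->
  exists A' B' C', [/\ A' \subset A, B' \subset B, C' \subset C,
    [/\ eta ^+ q * #|A|%:R <= #|A'|%:R, eta ^+ q * #|B|%:R <= #|B'|%:R &
        eta ^+ q * #|C|%:R <= #|C'|%:R] &
    (#|[set i in Z | F i \subset A' :|: B' :|: C']| * #|D| ^ q <= #|Z| * (2 * m) ^ q)%N].
Proof.
move=> /andP[eta0 eta1] s0 cD; elim=> [|q IHq] A B C Z regA regB regC cA cB cC bad.
  exists A, B, C; rewrite !expr0 !mul1r; split=> //; rewrite !expn0 !muln1.
  by apply: subset_leq_card; apply/subsetP => i; rewrite inE => /andP[].
have large (E : {set V}) : s%:R <= eta ^+ q.+1 * #|E|%:R :> R -> (s <= #|E|)%N.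
  move=> h; rewrite -(ler_nat R); apply: le_trans h _.
  by rewrite ler_piMl // exprn_ile1.
pose low E := [set d in D | (#|nbr e E d|)%:R < eta * #|E|%:R].
have lowA := regular_few_low s0 regA (subxx _) (large _ cA).
have lowB := regular_few_low s0 regB (subxx _) (large _ cB).
have lowC := regular_few_low s0 regC (subxx _) (large _ cC).
rewrite -/(low A) in lowA; rewrite -/(low B) in lowB; rewrite -/(low C) in lowC.
(* Each of the three sets has fewer than [s] low vertices and [D] has at least [6 * s], so at least
   half of [D] is usable for all three at once. *)
pose G := D :\: (low A :|: low B :|: low C).
have cG : (#|D| <= 2 * #|G|)%N.
  have h1 := cardsID (low A :|: low B :|: low C) D.
  have h2 := subset_leq_card (subsetIr D (low A :|: low B :|: low C)).
  have h3 := leq_of_leqif (leq_card_setU (low A :|: low B) (low C)).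
  have h4 := leq_of_leqif (leq_card_setU (low A) (low B)).
  move: h1 h2; rewrite -/G => h1 h2; clear -h1 h2 h3 h4 lowA lowB lowC cD.
  have := leq_trans h2 h3; lia.
pose Zd d := [set i in Z | F i \subset [set x | e d x]].
(* Double counting: a bad [F i] lies in the neighbourhood of at most [m] vertices of [D], and [G]
   has at least [#|D| / 2] vertices, so an average [d] in [G] keeps at most the fraction
   [2 * m / #|D|] of [Z]. *)
have [d dG Hd] : exists2 d, d \in G & (#|Zd d| * #|D| <= #|Z| * (2 * m))%N.
  apply/exists_inP; rewrite -[X in is_true X]negbK negb_exists_in; apply/negP.
  move=> /forall_inP all_gt.
  have [d0 d0G] : exists d, d \in G by apply/set0Pn; rewrite -card_gt0; clear -cG cD s0; lia.
  have le1 : (\sum_(d in G) #|Zd d| <= #|Z| * m)%N.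
    rewrite -sum_nat_const; apply: leq_trans (_ : \sum_(i in Z) #|common_nbr e D (F i)| <= _)%N;
      last by apply: leq_sum => i iZ; exact: bad.
    under eq_bigr do rewrite -sum1_card big_mkcond /=.
    rewrite exchange_big /= [leqRHS]big_mkcond; apply: leq_sum => i _ /=.
    case iZ: (i \in Z); last by rewrite big1 // => d _; rewrite inE iZ.
    rewrite -sum1_card -big_mkcondr /= !sum1_card; apply: subset_leq_card.
    apply/subsetP => d; rewrite [_ \in (fun _ => _)]unfold_in !inE => /andP[/andP[_ dD] /andP[_ /subsetP sF]].
    by rewrite dD; apply/forall_inP => x xF; rewrite e_sym; have := sF _ xF; rewrite inE.
  have : (\sum_(d in G) (#|Z| * (2 * m)).+1 <= \sum_(d in G) (#|Zd d| * #|D|))%N.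
    by apply: leq_sum => d dG; rewrite ltnNge all_gt.
  rewrite -big_distrl /= sum_nat_const => le2.
  have le3 : ((\sum_(d in G) #|Zd d|) * #|D| <= #|Z| * m * (2 * #|G|))%N by apply: leq_mul.
  have G0 : (0 < #|G|)%N by apply/card_gt0P; exists d0.
  have := leq_trans le2 le3; clear -G0; rewrite mulnS.
  have -> : (#|Z| * m * (2 * #|G|) = #|G| * (#|Z| * (2 * m)))%N by clear; lia.
  by move=> h; move: G0; clear -h; lia.
move: dG; rewrite !inE !negb_or => /andP[/andP[/andP[dA dB] dC] dD].
have good (E : {set V}) : ~~ ((d \in D) && ((#|nbr e E d|)%:R < eta * #|E|%:R)) ->
    eta * #|E|%:R <= (#|nbr e E d|)%:R by rewrite dD /= -leNgt.
have step (E : {set V}) : eta * #|E|%:R <= (#|nbr e E d|)%:R ->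
    eta ^+ q.+1 * #|E|%:R <= eta ^+ q * #|nbr e E d|%:R.
  by move=> h; rewrite exprSr -mulrA ler_wpM2l // exprn_ge0.
have nbr_sub E : nbr e E d \subset E by apply/subsetP => x; rewrite inE => /andP[].
have [|||||||A' [B' [C' [sA sB sC [hA hB hC] hZ]]]] :=
  IHq (nbr e A d) (nbr e B d) (nbr e C d) (Zd d).
- exact: lower_regular_sub (nbr_sub A) (subxx _) (leqnn _) regA.
- exact: lower_regular_sub (nbr_sub B) (subxx _) (leqnn _) regB.
- exact: lower_regular_sub (nbr_sub C) (subxx _) (leqnn _) regC.
- exact: le_trans cA (step _ (good _ dA)).
- exact: le_trans cB (step _ (good _ dB)).
- exact: le_trans cC (step _ (good _ dC)).
- by move=> i; rewrite inE => /andP[iZ _]; exact: bad.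
exists A', B', C'; split; first exact: subset_trans sA (nbr_sub _).
- exact: subset_trans sB (nbr_sub _).
- exact: subset_trans sC (nbr_sub _).
- by split; [apply: le_trans hA | apply: le_trans hB | apply: le_trans hC];
    apply: step; apply: good.
(* The final sets lie inside the neighbourhood of [d], so a bad set contained in them already
   belongs to [Zd d]. *)
apply: leq_trans (_ : #|[set i in Zd d | F i \subset A' :|: B' :|: C']| * #|D| ^ q.+1 <= _)%N.
  rewrite leq_mul2r; apply/orP; right; apply: subset_leq_card; apply/subsetP => i.
  rewrite !inE => /andP[-> sF] /=; rewrite sF andbT; apply: subset_trans sF _.
  apply/subsetP => x; rewrite !inE => /orP[/orP[]|] xE.
  - by have := subsetP sA _ xE; rewrite inE => /andP[].
  - by have := subsetP sB _ xE; rewrite inE => /andP[].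
  - by have := subsetP sC _ xE; rewrite inE => /andP[].
rewrite expnSr mulnA; apply: leq_trans (leq_mul hZ (leqnn #|D|)) _.
rewrite mulnAC; apply: leq_trans (leq_mul Hd (leqnn _)) _.
by rewrite expnS -[leqLHS]mulnA.
Qed.

(** Sets are indexed by maps from ['I_h], so at most [|V| ^ h] are bad at the start. A bad set
    inside the final sets would give [|D| ^ q <= |V| ^ h * (2 * m) ^ q], against [s <= |D|] and the
    last hypothesis. *)
Lemma dependent_choice (h q : nat) (eta : R) A B C D (s m : nat) :
  0 <= eta <= 1 -> (0 < s)%N -> (6 * s <= #|D|)%N ->
  lower_regular e A D eta s -> lower_regular e B D eta s -> lower_regular e C D eta s ->
  s%:R <= eta ^+ q * #|A|%:R -> s%:R <= eta ^+ q * #|B|%:R -> s%:R <= eta ^+ q * #|C|%:R ->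
  (#|V| ^ h * (2 * m) ^ q < s ^ q)%N ->
  exists A' B' C', [/\ A' \subset A, B' \subset B, C' \subset C,
    [/\ eta ^+ q * #|A|%:R <= #|A'|%:R, eta ^+ q * #|B|%:R <= #|B'|%:R &
        eta ^+ q * #|C|%:R <= #|C'|%:R] &
    forall T, T != set0 -> (#|T| <= h)%N -> T \subset A' :|: B' :|: C' ->
      (m < #|common_nbr e D T|)%N].
Proof.
move=> eta01 s0 cD regA regB regC cA cB cC small.
pose F (f : {ffun 'I_h -> V}) := f @: [set: 'I_h].
pose Z := [set f | (#|common_nbr e D (F f)| <= m)%N].
have [|A' [B' [C' [sA sB sC hABC hZ]]]] :=
  dependent_choice_iter (F := F) (m := m) eta01 s0 cD (Z := Z) regA regB regC cA cB cC.
  by move=> f; rewrite inE.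
exists A', B', C'; split=> // T /set0Pn[x0 x0T] cT sT; rewrite ltnNge; apply/negP => badT.
(* A set with fewer than [h] elements is still an image: the default [x0], itself in [T], fills the
   remaining places. *)
pose f : {ffun 'I_h -> V} := [ffun i => nth x0 (enum T) (nat_of_ord i)].
have Ef : F f = T.
  apply/setP => x; apply/imsetP/idP => [[i _ ->]|xT].
    rewrite ffunE; have [lt_i|le_i] := ltnP i (size (enum T)).
      by rewrite -mem_enum mem_nth.
    by rewrite nth_default.
  have lt_x : (index x (enum T) < h)%N.
    by apply: leq_trans cT; rewrite cardE index_mem mem_enum.
  by exists (Ordinal lt_x) => //; rewrite ffunE /= nth_index // mem_enum.
have : (0 < #|[set i in Z | F i \subset A' :|: B' :|: C']|)%N.
  by apply/card_gt0P; exists f; rewrite !inE Ef badT.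
move=> pos; have := leq_trans (leq_mul pos (leqnn _)) hZ; rewrite mul1n leqNgt => /negP; apply.
apply: leq_ltn_trans (_ : #|V| ^ h * (2 * m) ^ q < _)%N.
  by rewrite leq_mul2r; apply/orP; right; rewrite -[h in leqRHS]card_ord -card_ffun max_card.
apply: leq_trans small _; by case: (q) => // q1; rewrite leq_exp2r //; clear -cD; lia.
Qed.

End Embedding.

(** * Cliques in lower-regular families *)

Definition clique (V : finType) (e : rel V) (T : {set V}) : bool :=
  [forall x in T, forall y in T, (x != y) ==> e x y].

Lemma cliqueP (V : finType) (e : rel V) (T : {set V}) :
  reflect {in T &, forall x y, x != y -> e x y} (clique e T).
Proof.
apply: (iffP forall_inP) => [H x y xT yT xy|H x xT].
  by have /forall_inP/(_ y yT)/implyP/(_ xy) := H x xT.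
by apply/forall_inP => y yT; apply/implyP; exact: H.
Qed.

(** The cost of regularising one set successively against three others. The later steps, with costs
    [K2] and [K3], raise the threshold while the first partner keeps its size; to end with ratio
    [L], the first step must therefore aim at [L * K2 * K3] and the second at [L * K3]. *)
Definition ext_bound (R : archiRealFieldType) (beta : R) (L : nat) : nat :=
  let K3 := regular_bound beta L in
  let K2 := regular_bound beta (L * K3) in
  regular_bound beta (L * K2 * K3) * K2 * K3.

Lemma ext_bound_gt0 (R : archiRealFieldType) (beta : R) (L : nat) :
  (0 < L)%N -> (0 < ext_bound beta L)%N.
Proof. by move=> L0; rewrite /ext_bound !(muln_gt0, regular_bound_gt0, L0). Qed.

Section Cliques.
Variables (R : archiRealFieldType) (V : finType) (e : rel V).
Hypotheses (e_sym : symmetric e) (e_irr : irreflexive e).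
Implicit Types (A B C D S T X W : {set V}) (p eta : R) (s : nat).

Lemma clique_join D T1 T2 : clique e T1 -> clique e T2 -> T2 \subset common_nbr e D T1 ->
  clique e (T1 :|: T2) /\ #|T1 :|: T2| = (#|T1| + #|T2|)%N.
Proof.
move=> /cliqueP c1 /cliqueP c2 /subsetP sT.
have adj x y : x \in T1 -> y \in T2 -> e x y.
  by move=> xT yT; have := sT _ yT; rewrite inE => /andP[_ /forall_inP/(_ x xT)].
split.
  apply/cliqueP => x y; rewrite !inE => /orP[xT|xT] /orP[yT|yT] xy.
  - exact: c1.
  - exact: adj.
  - by rewrite e_sym adj.
  - exact: c2.
apply/eqP; rewrite (leq_card_setU T1 T2).2; apply/pred0P => x /=.
by apply/negP => /andP[xT yT]; have := adj _ _ xT yT; rewrite e_irr.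
Qed.

(** Union bound over the parts of [A] missed by the vertices of [T]. For five vertices the left side
    is positive precisely when [c] exceeds 4/5. *)
Lemma common_nbr_card A T (c : R) : {in T, forall x, c * #|A|%:R <= #|nbr e A x|%:R} ->
  (1 - #|T|%:R * (1 - c)) * #|A|%:R <= #|common_nbr e A T|%:R.
Proof.
move=> Hc.
have h1 : (#|A| <= #|common_nbr e A T| + \sum_(x in T) #|A :\: nbr e A x|)%N.
  rewrite -(cardsID (common_nbr e A T) A) leq_add //.
    by apply: subset_leq_card; exact: subsetIr.
  pose g x : {set V} := A :\: nbr e A x.
  apply: leq_trans (_ : #|\bigcup_(x in T) g x| <= _)%N.
    apply: subset_leq_card; apply/subsetP => y; rewrite !inE negb_and => /andP[H yA].
    move: H; rewrite yA /= negb_forall_in => /exists_inP[x xT nxy].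
    by apply/bigcupP; exists x => //; rewrite !inE yA nxy.
  elim/big_rec2: _ => [|x k U _ IH]; first by rewrite cards0.
  exact: leq_trans (leq_of_leqif (leq_card_setU _ _)) (leq_add (leqnn _) IH).
have h2 : (\sum_(x in T) #|A :\: nbr e A x|)%:R <= \sum_(x in T) (1 - c) * #|A|%:R.
  rewrite natr_sum; apply: ler_sum => x xT; have := Hc _ xT.
  have sA : nbr e A x \subset A by apply/subsetP => y; rewrite inE => /andP[].
  rewrite -(cardsID (nbr e A x) A) (setIidPr sA) natrD.
  move: #|nbr e A x|%:R #|A :\: _|%:R => a b; clear; lra.
move: h1 h2; rewrite -(ler_nat R) natrD sumr_const -[_ *+ #|T|]mulr_natr.
move: (\sum_(x in T) _)%N%:R => x; clear; lra.
Qed.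

(** 11 = 5 + 3 + 3 is the largest clique to which a triangle will still be added. *)
Definition rich (m : nat) D (U : {set V}) := forall T, T != set0 -> (#|T| <= 11)%N -> T \subset U ->
  (m < #|common_nbr e D T|)%N.

Variables (s0 m q : nat).
Hypothesis s0_gt0 : (0 < s0)%N.
Hypothesis q_gt0 : (0 < q)%N.
Hypothesis K5 : forall W, (s0 <= #|W|)%N -> exists T, [/\ T \subset W, #|T| = 5 & clique e T].
Hypothesis K3 : forall W, (m < #|W|)%N -> exists T, [/\ T \subset W, #|T| = 3 & clique e T].
Hypothesis small : (#|V| ^ 11 * (2 * m) ^ q < s0 ^ q)%N.

Lemma rich_clique D (U : {set V}) T : rich m D U -> T \subset U -> clique e T ->
  (0 < #|T| <= 11)%N -> exists T', [/\ T' \subset T :|: D, #|T'| = (#|T| + 3)%N & clique e T'].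
Proof.
move=> richD sT cT /andP[T0 T11].
have [|T3 [sT3 ET3 cT3]] := K3 (richD T _ T11 sT); first by rewrite -card_gt0.
have [cl Ecl] := clique_join cT cT3 sT3.
exists (T :|: T3); split=> //; last by rewrite Ecl ET3.
apply: setUS; apply: subset_trans sT3 _.
by apply/subsetP => y; rewrite inE => /andP[].
Qed.

Lemma small_le s : (s0 <= s)%N -> (#|V| ^ 11 * (2 * m) ^ q < s ^ q)%N.
Proof. by move=> le_s; apply: leq_trans small _; rewrite leq_exp2r. Qed.

Lemma rich_subsets eta A B C D s : 0 <= eta <= 1 -> (s0 <= s)%N -> (6 * s <= #|D|)%N ->
  lower_regular e A D eta s -> lower_regular e B D eta s -> lower_regular e C D eta s ->
  s%:R <= eta ^+ q * #|A|%:R -> s%:R <= eta ^+ q * #|B|%:R -> s%:R <= eta ^+ q * #|C|%:R ->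
  exists A' B' C', [/\ A' \subset A, B' \subset B, C' \subset C,
    [/\ eta ^+ q * #|A|%:R <= #|A'|%:R, eta ^+ q * #|B|%:R <= #|B'|%:R &
        eta ^+ q * #|C|%:R <= #|C'|%:R] & rich m D (A' :|: B' :|: C')].
Proof.
move=> eta01 le_s cD regA regB regC cA cB cC.
have s_gt0 : (0 < s)%N by apply: leq_trans le_s.
exact: (dependent_choice e_sym eta01 s_gt0 cD regA regB regC cA cB cC (small_le le_s)).
Qed.

(** The sets are made rich towards [D], then [C], then [B], and the clique grows in the opposite
    order, from a 5-clique in what is left of [A]. Since [A] is shrunk three times, each time by
    [eta ^ q], the exponent is [q + q + q]. The clique obtained has 14 vertices. *)
Lemma four_regular_clique eta A B C D s : 0 <= eta <= 1 -> (s0 <= s)%N ->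
  lower_regular e A B eta s -> lower_regular e A C eta s -> lower_regular e B C eta s ->
  lower_regular e A D eta s -> lower_regular e B D eta s -> lower_regular e C D eta s ->
  (6 * s)%:R <= eta ^+ (q + q + q) * #|A|%:R -> (6 * s)%:R <= eta ^+ (q + q + q) * #|B|%:R ->
  (6 * s)%:R <= eta ^+ (q + q + q) * #|C|%:R -> (6 * s)%:R <= eta ^+ (q + q + q) * #|D|%:R ->
  exists2 T : {set V}, (13 <= #|T|)%N & clique e T.
Proof.
move=> eta01 le_s regAB regAC regBC regAD regBD regCD.
rewrite !exprD; have /andP[eta0 eta1] := eta01.
set t := eta ^+ q.
have t01 : 0 <= t <= 1 by rewrite exprn_ge0 ?exprn_ile1.
have /andP[t0 t1] := t01.
have mono (x y z : R) : x <= t * z -> z <= y -> x <= t * y.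
  by move=> h zy; apply: le_trans h _; exact: ler_wpM2l.
rewrite -!mulrA => cA cB cC cD.
have w1 (W : {set V}) : t * #|W|%:R <= #|W|%:R by rewrite ler_piMl.
have w2 (W : {set V}) : t * (t * #|W|%:R) <= t * #|W|%:R by rewrite ler_wpM2l.
have w3 (W : {set V}) : t * (t * (t * #|W|%:R)) <= t * (t * #|W|%:R).
  by rewrite ler_wpM2l.
have cA2t := le_trans cA (w3 A); have cB2t := le_trans cB (w3 B).
have cC2t := le_trans cC (w3 C); have cD2t := le_trans cD (w3 D).
have cAt := le_trans cA2t (w2 A); have cBt := le_trans cB2t (w2 B).
have cCt := le_trans cC2t (w2 C); have cDt := le_trans cD2t (w2 D).
have s6 : s%:R <= (6 * s)%:R :> R by rewrite ler_nat leq_pmull.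
have cD' : (6 * s <= #|D|)%N by rewrite -(ler_nat R); apply: le_trans cDt _.
have [|||A1 [B1 [C1 [sA1 sB1 sC1 [cA1 cB1 cC1] rD]]]] :=
  rich_subsets eta01 le_s cD' regAD regBD regCD.
- exact: le_trans s6 cAt.
- exact: le_trans s6 cBt.
- exact: le_trans s6 cCt.
rewrite -/t in cA1 cB1 cC1.
have cC1' : (6 * s <= #|C1|)%N.
  by rewrite -(ler_nat R); apply: le_trans cC1.
(* Only two sets remain to be made rich towards [C1]; [B1] fills the third place too. *)
have [|||A2 [B2 [B2' [sA2 sB2 sB2' [cA2 cB2 _] rC]]]] :=
  rich_subsets (A := A1) (B := B1) (C := B1) eta01 le_s cC1'
    (lower_regular_sub sA1 sC1 (leqnn _) regAC) (lower_regular_sub sB1 sC1 (leqnn _) regBC)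
    (lower_regular_sub sB1 sC1 (leqnn _) regBC).
- by apply: le_trans s6 _; apply: mono cA1.
- by apply: le_trans s6 _; apply: mono cB1.
- by apply: le_trans s6 _; apply: mono cB1.
rewrite -/t in cA2 cB2.
have {}cA2 : t * (t * #|A|%:R) <= #|A2|%:R by apply: le_trans cA2; exact: ler_wpM2l.
have {}cB2 : t * (t * #|B|%:R) <= #|B2|%:R by apply: le_trans cB2; exact: ler_wpM2l.
have cB2' : (6 * s <= #|B2|)%N.
  by rewrite -(ler_nat R); apply: le_trans cB2.
have sA2A := subset_trans sA2 sA1; have sB2B := subset_trans sB2 sB1.
have regAB2 := lower_regular_sub sA2A sB2B (leqnn _) regAB.
have cA2s : s%:R <= t * #|A2|%:R by apply: le_trans s6 _; apply: mono cA2.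
have [A3 [A3' [A3'' [sA3 _ _ [cA3 _ _] rB]]]] :=
  rich_subsets eta01 le_s cB2' regAB2 regAB2 regAB2 cA2s cA2s cA2s.
have [|T5 [sT5 ET5 cT5]] := K5 (W := A3).
  by apply: leq_trans le_s _; rewrite -(ler_nat R); apply: le_trans cA3.
have [| |T8 [sT8 ET8 cT8]] := rich_clique rB _ cT5; rewrite ?ET5 //.
  by apply: subset_trans sT5 _; rewrite -setUA subsetUl.
rewrite ET5 in ET8.
have [| |T11 [sT11 ET11 cT11]] := rich_clique rC _ cT8; rewrite ?ET8 //.
  apply: subset_trans sT8 _; apply: subset_trans _ (subsetUl _ _).
  by apply: setSU; apply: subset_trans sA3; exact: sT5.
rewrite ET8 in ET11.
have [| |T14 [sT14 ET14 cT14]] := rich_clique rD _ cT11; rewrite ?ET11 //.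
  apply: subset_trans sT11 _; apply: setSU; apply: subset_trans sT8 _.
  by apply: setUSS; [apply: subset_trans sA2; apply: subset_trans sA3; exact: sT5 | exact: sB2].
by exists T14 => //; rewrite ET14 ET11.
Qed.

(** [X] and [A] are made rich towards [B] first. A 5-clique among the vertices of [X1] of high
    degree to [A1] then has a linear common neighbourhood there, which holds a second 5-clique; the
    resulting 10 vertices extend by a triangle of [B]. *)
Lemma dense_triple_clique eta X A B s : 0 <= eta <= 1 -> (s0 <= s)%N ->
  lower_regular e X B eta s -> lower_regular e A B eta s ->
  lower_regular e A X (4 / 5 + eta) s ->
  (6 * s)%:R <= eta ^+ (q + q + q) * #|X|%:R -> (6 * s)%:R <= eta ^+ (q + q + q) * #|A|%:R ->
  (6 * s)%:R <= eta ^+ (q + q + q) * #|B|%:R ->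
  exists2 T : {set V}, (13 <= #|T|)%N & clique e T.
Proof.
move=> eta01 le_s regXB regAB regAX cX cA cB.
have /andP[eta0 eta1] := eta01.
have s6 : s%:R <= (6 * s)%:R :> R by rewrite ler_nat leq_pmull.
have cB' : (6 * s <= #|B|)%N.
  by rewrite -(ler_nat R); apply: le_trans cB _; rewrite ler_piMl ?exprn_ile1.
have E3q : eta ^+ (q + q + q) = eta ^+ (q + q) * eta ^+ q by rewrite exprD.
have up (W : {set V}) : eta ^+ (q + q + q) * #|W|%:R <= eta ^+ q * #|W|%:R.
  rewrite E3q -mulrA ler_piMl ?exprn_ile1 //.
  by rewrite mulr_ge0 ?exprn_ge0.
have hX : s%:R <= eta ^+ q * #|X|%:R by apply: le_trans s6 (le_trans cX (up _)).
have hA : s%:R <= eta ^+ q * #|A|%:R by apply: le_trans s6 (le_trans cA (up _)).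
have [X1 [A1 [A1' [sX1 sA1 _ [cX1 cA1 _] rB]]]] :=
  rich_subsets eta01 le_s cB' regXB regAB regAB hX hA hA.
have s_gt0 : (0 < s)%N by apply: leq_trans le_s.
have cA1s : (s <= #|A1|)%N by rewrite -(ler_nat R); apply: le_trans cA1.
have cX1s : (6 * s <= #|X1|)%N.
  by rewrite -(ler_nat R); apply: le_trans cX1; apply: le_trans cX (up _).
have few := regular_few_low e_sym s_gt0 (lower_regular_sub (subxx _) sX1 (leqnn _) regAX) sA1 cA1s.
set low := [set d in X1 | _] in few.
have [|T1 [sT1 ET1 cT1]] := K5 (W := X1 :\: low).
  apply: leq_trans le_s _; have h := cardsID low X1.
  have h' := subset_leq_card (subsetIr X1 low).
  by clear -h h' few cX1s; lia.
have cN : s%:R <= #|common_nbr e A1 T1|%:R :> R.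
  apply: le_trans (common_nbr_card (c := 4 / 5 + eta) (T := T1) (A := A1) _); last first.
    move=> x xT; have := subsetP sT1 _ xT; rewrite !inE => /andP[H xX]; move: H.
    by rewrite xX /= -leNgt.
  (* The excess [eta] over 4/5 leaves a proportion [5 * eta] of [A1] adjacent to all five
     vertices. *)
  rewrite ET1; have -> : 1 - 5 * (1 - (4 / 5 + eta)) = 5 * eta :> R by field.
  have h1 : eta ^+ (q + q + q) * #|A|%:R <= eta * #|A1|%:R.
    apply: le_trans (_ : eta * (eta ^+ q * #|A|%:R) <= _); last by rewrite ler_wpM2l.
    rewrite mulrA ler_wpM2r // -exprS ler_wiXn2l //; clear -q_gt0; lia.
  have h2 : 0 <= eta * #|A1|%:R by rewrite mulr_ge0.
  have := le_trans s6 (le_trans cA h1).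
  by rewrite -mulrA; move: (eta * _) h2 => z; lra.
have [|T2 [sT2 ET2 cT2]] := K5 (W := common_nbr e A1 T1).
  by apply: leq_trans le_s _; rewrite -(ler_nat R).
have [cT12 ET12] := clique_join cT1 cT2 sT2.
have [| | T13 [_ ET13 cT13]] := rich_clique rB _ cT12.
- apply: subset_trans _ (subsetUl _ _); apply: setUSS.
    by apply: subset_trans sT1 _; exact: subsetDl.
  by apply: subset_trans sT2 _; apply/subsetP => y; rewrite inE => /andP[].
- by rewrite ET12 ET1 ET2.
by exists T13 => //; rewrite ET13 ET12 ET1 ET2.
Qed.

End Cliques.

(** * Finding the configurations *)

Section Extension.
Variables (R : archiRealFieldType) (V : finType) (e : rel V).
Hypothesis e_sym : symmetric e.
Implicit Types (A B C D S T X W : {set V}) (p eta : R) (s : nat).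

Lemma ecount_ge A X p : {in X, forall x, p * #|A|%:R <= #|nbr e A x|%:R} ->
  p * #|A|%:R * #|X|%:R <= (ecount e A X)%:R.
Proof.
move=> H; rewrite ecountC // /ecount natr_sum.
have -> : p * #|A|%:R * #|X|%:R = \sum_(x in X) p * #|A|%:R by rewrite sumr_const mulr_natr.
exact: ler_sum.
Qed.

(** [X] is cut down once for each partner, and no control remains over which subset survives; this
    is why the density hypotheses bear on every vertex of [X]. Earlier pairs stay lower-regular
    because thresholds only grow. To attach just two sets, one of them is passed twice. *)
Lemma regular_extension (beta : R) (L s : nat) A B C X (pA pB pC : R) :
  0 < beta -> (1 < L)%N -> (0 < s)%N -> 0 <= pA -> 0 <= pB -> 0 <= pC ->
  (ext_bound beta L * s <= #|A|)%N -> (ext_bound beta L * s <= #|B|)%N ->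
  (ext_bound beta L * s <= #|C|)%N -> (ext_bound beta L * s <= #|X|)%N ->
  {in X, forall x, pA * #|A|%:R <= #|nbr e A x|%:R} ->
  {in X, forall x, pB * #|B|%:R <= #|nbr e B x|%:R} ->
  {in X, forall x, pC * #|C|%:R <= #|nbr e C x|%:R} ->
  exists s' A' B' C' X', [/\ A' \subset A, B' \subset B, C' \subset C, X' \subset X &
    [/\ (s <= s' <= ext_bound beta L * s)%N,
     [/\ (L * s' <= #|A'|)%N, (L * s' <= #|B'|)%N, (L * s' <= #|C'|)%N & (L * s' <= #|X'|)%N],
     lower_regular e A' X' (pA - beta) s', lower_regular e B' X' (pB - beta) s' &
     lower_regular e C' X' (pC - beta) s']].
Proof.
move=> beta0 L1 s0 pA0 pB0 pC0; have L0 : (0 < L)%N by apply: ltn_trans L1.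
rewrite /ext_bound; set K3 := regular_bound beta L.
have K30 : (0 < K3)%N by exact: regular_bound_gt0.
have LK3 : (1 < L * K3)%N by apply: leq_trans L1 _; rewrite leq_pmulr.
set K2 := regular_bound beta (L * K3).
have K20 : (0 < K2)%N by rewrite regular_bound_gt0 // ltnW.
have LK23 : (1 < L * K2 * K3)%N by rewrite mulnAC; apply: leq_trans LK3 _; rewrite leq_pmulr.
set K1 := regular_bound beta (L * K2 * K3).
move=> cA cB cC cX dA dB dC.
have le1 : (K1 * s <= K1 * K2 * K3 * s)%N by rewrite leq_mul2r -mulnA leq_pmulr ?orbT // muln_gt0 K20.
have [s1 [A1 [X1 [s_s1 s1_K sA1 sX1 [cA1 cX1 reg1]]]]] :=
  regular_pair e_sym beta0 LK23 s0 pA0 (leq_trans le1 cA) (leq_trans le1 cX) (ecount_ge dA).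
rewrite -/K1 in s1_K.
have s10 : (0 < s1)%N by apply: leq_trans s_s1.
have le2 : (K2 * s1 <= K1 * K2 * K3 * s)%N.
  apply: leq_trans (leq_mul (leqnn K2) s1_K) _; rewrite mulnA [(K2 * K1)%N]mulnC.
  by rewrite leq_mul2r leq_pmulr ?orbT.
have le2' : (K2 * s1 <= #|X1|)%N.
  by rewrite cX1 leq_mul2r mulnC mulnA leq_pmull ?orbT // muln_gt0 K30.
have [s2 [B2 [X2 [s1_s2 s2_K sB2 sX2 [cB2 cX2 reg2]]]]] :=
  regular_pair e_sym beta0 LK3 s10 pB0 (leq_trans le2 cB) le2'
    (ecount_ge (sub_in1 (subsetP sX1) dB)).
rewrite -/K2 in s2_K.
have s20 : (0 < s2)%N by apply: leq_trans s1_s2.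
have le3 : (K3 * s2 <= K1 * K2 * K3 * s)%N.
  apply: leq_trans (leq_mul (leqnn K3) s2_K) _; rewrite mulnA.
  apply: leq_trans (leq_mul (leqnn _) s1_K) _.
  by rewrite eq_leq // !mulnA; congr (_ * _)%N; rewrite mulnC mulnA -mulnA [(K3 * _)%N]mulnC mulnA.
have le3' : (K3 * s2 <= #|X2|)%N by rewrite cX2 leq_mul2r leq_pmull ?orbT.
have sX21 := subset_trans sX2 sX1.
have [s3 [C3 [X3 [s2_s3 s3_K sC3 sX3 [cC3 cX3 reg3]]]]] :=
  regular_pair e_sym beta0 L1 s20 pC0 (leq_trans le3 cC) le3'
    (ecount_ge (sub_in1 (subsetP sX21) dC)).
rewrite -/K3 in s3_K.
exists s3, A1, B2, C3, X3; split=> //; first exact: subset_trans sX3 sX21.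
have LB : (L * s3 <= #|B2|)%N by rewrite cB2 -mulnA leq_mul2l s3_K orbT.
split.
- rewrite (leq_trans s_s1 (leq_trans s1_s2 s2_s3)) /=; apply: leq_trans s3_K le3.
- split=> //; rewrite ?cC3 ?cX3 //; apply: leq_trans LB _; rewrite cB2 cA1.
  rewrite [X in (_ <= X * _)%N]mulnAC -[leqRHS]mulnA leq_mul2l s2_K orbT //.
- exact: lower_regular_sub (subxx _) (subset_trans sX3 sX2) (leq_trans s1_s2 s2_s3) reg1.
- exact: lower_regular_sub (subxx _) sX3 s2_s3 reg2.
- exact: reg3.
Qed.

Definition density A x : R := #|nbr e A x|%:R / #|A|%:R.

Lemma density_ge p A x : (0 < #|A|)%N -> (p <= density A x) = (p * #|A|%:R <= #|nbr e A x|%:R).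
Proof. by move=> A0; rewrite /density ler_pdivlMr // ltr0n. Qed.

Lemma density_le1 A x : density A x <= 1.
Proof.
rewrite /density; have [->|] := posnP #|A|; first by rewrite invr0 mulr0.
move=> A0; rewrite ler_pdivrMr ?ltr0n // mul1r ler_nat; apply: subset_leq_card.
by apply/subsetP => y; rewrite inE => /andP[].
Qed.

Lemma sum_density (d : R) A S : (0 < #|A|)%N -> A \subset S ->
  {in S, forall v, d * #|S|%:R <= #|nbr e S v|%:R} ->
  d * #|S|%:R <= \sum_(v in S) density A v.
Proof.
move=> A0 sA dS; rewrite /density -mulr_suml ler_pdivlMr ?ltr0n //.
rewrite -natr_sum -/(ecount e S A).
by apply: ecount_ge => x xA; apply: dS; exact: (subsetP sA).
Qed.

(** A reverse Markov inequality: values are at most [a] off [X] and at most [a + b] on it, so an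
    average of at least [c] forces [X] to be large. *)
Lemma exceptional_card (f : V -> R) S X (a b c : R) : X \subset S ->
  {in S, forall v, f v <= a + (v \in X)%:R * b} -> c * #|S|%:R <= \sum_(v in S) f v ->
  (c - a) * #|S|%:R <= b * #|X|%:R.
Proof.
move=> sX Hf /le_trans/(_ (ler_sum _ Hf)).
rewrite big_split /= sumr_const -[a *+ _]mulr_natr -mulr_suml -natr_sum.
have -> : (\sum_(i in S) (i \in X) = #|X|)%N.
  rewrite -sum1_card big_mkcond [RHS]big_mkcond; apply: eq_bigr => i _ /=.
  by case iX: (i \in X); [rewrite (subsetP sX) | case: ifP].
by move=> h; rewrite mulrBl lerBlDr addrC [b * _]mulrC.
Qed.

(** If one density is below [mu] and the sum exceeds [8 / 5 + 3 * mu], the other two sum to more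
    than [8 / 5 + 2 * mu]. Hence the larger is at least [4 / 5 + mu], and the smaller exceeds 3/5
    because no density exceeds 1. *)
Lemma three_density_sum (mu a b c : R) : 0 <= mu -> a <= 1 -> b <= 1 -> c <= 1 ->
  a + b + c <= 8 / 5 + 3 * mu +
    ([&& mu <= a, mu <= b & mu <= c]
     || (4 / 5 + mu <= a) && (mu <= b) || (4 / 5 + mu <= b) && (mu <= a)
     || (4 / 5 + mu <= a) && (mu <= c) || (4 / 5 + mu <= c) && (mu <= a)
     || (4 / 5 + mu <= b) && (mu <= c) || (4 / 5 + mu <= c) && (mu <= b))%:R * 2.
Proof.
move=> mu0 a1 b1 c1; case: (boolP (_ || _)) => [_|]; first by rewrite mul1r; lra.
rewrite mul0r addr0; apply: contraNT; rewrite -ltNge => lt_abc.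
have two x y z : x <= 1 -> y <= 1 -> x + y + z = a + b + c -> z < mu ->
    (4 / 5 + mu <= x) && (mu <= y) || (4 / 5 + mu <= y) && (mu <= x).
  move=> x1 y1 Exyz z_lt; have [hx|hx] := lerP (4 / 5 + mu) x; have [hy|hy] := lerP mu y => //=.
  - by exfalso; lra.
  - by apply/andP; split; lra.
  - by exfalso; lra.
have [hc|hc] := lerP mu c; last first.
  by have /orP[->|->] := two a b c a1 b1 (erefl _) hc; rewrite ?orbT.
have [hb|hb] := lerP mu b; last first.
  have E : a + c + b = a + b + c by ring.
  by have /orP[/andP[-> _]|->] := two a c b a1 c1 E hb; rewrite ?orbT.
have [ha|ha] //= := lerP mu a.
have E : b + c + a = a + b + c by ring.
by have /orP[/andP[-> _]|/andP[-> _]] := two b c a b1 c1 E ha; rewrite ?orbT.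
Qed.

End Extension.

(** * Cliques on 13 vertices from a minimum degree condition *)

Section Main.
Variables (R : archiRealFieldType) (mu : R).

(** Regularising costs [eta] in density, so [mu] drops to [eta] and [4 / 5 + mu] to
    [4 / 5 + eta]. *)
Let eta := mu / 2.

(* Size ratios chosen backwards: each extension step must leave sets large
   enough for the next one.  The factor 7 pays for the final pigeonhole over
   four-set configurations (one) and ordered dense pairs of the triple (six). *)
Definition core_size : nat := (Num.bound (6 / eta ^+ 360)).+2.
Definition triple_size : nat := (ext_bound eta core_size).+2.
Definition pair_size : nat := (ext_bound eta triple_size).+2.
Definition host_size : nat :=
  7 * ext_bound eta core_size * ext_bound eta triple_size * regular_bound eta pair_size.

Lemma core_sizeP (V : finType) (A : {set V}) (s : nat) : 0 < mu ->
  (core_size * s <= #|A|)%N -> (6 * s)%:R <= eta ^+ (120 + 120 + 120) * #|A|%:R.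
Proof.
move=> mu0 cA; have eta0 : 0 < eta by rewrite divr_gt0.
have h : 6 <= eta ^+ 360 * core_size%:R.
  rewrite mulrC -ler_pdivrMr ?exprn_gt0 //.
  apply: ltW; apply: lt_le_trans (archi_boundP _) _; last by rewrite ler_nat (leqW (leqnSn _)).
  by rewrite divr_ge0 // exprn_ge0 // ltW.
apply: le_trans (_ : eta ^+ 360 * core_size%:R * s%:R <= _).
  by rewrite natrM ler_wpM2r.
rewrite -mulrA -natrM ler_wpM2l ?ler_nat //.
by rewrite exprn_ge0 // ltW.
Qed.

Variables (V : finType) (e : rel V) (S : {set V}) (s m : nat).
Hypotheses (e_sym : symmetric e) (e_irr : irreflexive e) (mu_gt0 : 0 < mu) (mu_le : mu <= 1 / 100).
Hypothesis s_gt0 : (0 < s)%N.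
Hypothesis K5 : forall W : {set V}, (s <= #|W|)%N -> exists T : {set V}, [/\ T \subset W, #|T| = 5 & clique e T].
Hypothesis K3 : forall W : {set V}, (m < #|W|)%N -> exists T : {set V}, [/\ T \subset W, #|T| = 3 & clique e T].
Hypothesis small : (#|V| ^ 11 * (2 * m) ^ 120 < s ^ 120)%N.
Hypothesis degS : {in S, forall v, (8 / 15 + 2 * mu) * #|S|%:R <= #|nbr e S v|%:R}.
Hypothesis cardS : (host_size * s)%:R <= mu * #|S|%:R.

Let eta_gt0 : 0 < eta. Proof. by rewrite divr_gt0. Qed.
Let eta01 : 0 <= eta <= 1.
Proof. by rewrite ltW //= /eta; move: mu_le; rewrite !ler_pdivlMr ?ler_pdivrMr //; lra. Qed.

Implicit Types (A B C X : {set V}).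

Lemma four_case A B C X s1 : (s <= s1)%N ->
  lower_regular e A B eta s1 -> lower_regular e A C eta s1 -> lower_regular e B C eta s1 ->
  (ext_bound eta core_size * s1 <= #|A|)%N -> (ext_bound eta core_size * s1 <= #|B|)%N ->
  (ext_bound eta core_size * s1 <= #|C|)%N -> (ext_bound eta core_size * s1 <= #|X|)%N ->
  {in X, forall x, mu * #|A|%:R <= #|nbr e A x|%:R} ->
  {in X, forall x, mu * #|B|%:R <= #|nbr e B x|%:R} ->
  {in X, forall x, mu * #|C|%:R <= #|nbr e C x|%:R} ->
  exists2 T : {set V}, (13 <= #|T|)%N & clique e T.
Proof.
move=> le_s regAB regAC regBC cA cB cC cX dA dB dC.
have s10 := leq_trans s_gt0 le_s; have mu0 := ltW mu_gt0.
have [s2 [A' [B' [C' [X' [sA sB sC _ [/andP[s12 _] [cA' cB' cC' cX'] rA rB rC]]]]]]] :=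
  regular_extension e_sym eta_gt0 (isT : 1 < core_size)%N s10 mu0 mu0 mu0 cA cB cC cX dA dB dC.
have Eeta : mu - eta = eta by rewrite /eta; field.
rewrite Eeta in rA rB rC.
apply: (four_regular_clique e_sym e_irr s_gt0 (q := 120) isT K5 K3 small eta01 (leq_trans le_s s12)
  (lower_regular_sub sA sB s12 regAB) (lower_regular_sub sA sC s12 regAC)
  (lower_regular_sub sB sC s12 regBC) rA rB rC); exact: core_sizeP.
Qed.

Lemma three_case A B X s1 : (s <= s1)%N -> lower_regular e A B eta s1 ->
  (ext_bound eta core_size * s1 <= #|A|)%N -> (ext_bound eta core_size * s1 <= #|B|)%N ->
  (ext_bound eta core_size * s1 <= #|X|)%N ->
  {in X, forall x, (4 / 5 + mu) * #|A|%:R <= #|nbr e A x|%:R} ->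
  {in X, forall x, mu * #|B|%:R <= #|nbr e B x|%:R} ->
  exists2 T : {set V}, (13 <= #|T|)%N & clique e T.
Proof.
move=> le_s regAB cA cB cX dA dB.
have s10 := leq_trans s_gt0 le_s; have mu0 := ltW mu_gt0.
have mu1 : 0 <= 4 / 5 + mu by lra.
have [s2 [A' [B' [C' [X' [sA sB _ _ [/andP[s12 _] [cA' cB' _ cX'] rA rB _]]]]]]] :=
  regular_extension e_sym eta_gt0 (isT : 1 < core_size)%N s10 mu1 mu0 mu0 cA cB cB cX dA dB dB.
have EA : 4 / 5 + mu - eta = 4 / 5 + eta by rewrite /eta; field.
have EB : mu - eta = eta by rewrite /eta; field.
rewrite EA in rA; rewrite EB in rB.
apply: (dense_triple_clique e_sym e_irr s_gt0 (q := 120) isT K5 K3 small eta01 (leq_trans le_s s12)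
  (lower_regularC e_sym rB) (lower_regular_sub sA sB s12 regAB) rA); exact: core_sizeP.
Qed.

Lemma clique_of_min_degree : exists2 T : {set V}, (13 <= #|T|)%N & clique e T.
Proof.
pose d := 8 / 15 + 2 * mu.
have degSd : {in S, forall v, d * #|S|%:R <= #|nbr e S v|%:R} := degS.
have d0 : 0 <= d by rewrite /d; have := mu_gt0; lra.
have mu0 := ltW mu_gt0.
have E5 : d - eta = 8 / 15 + 3 / 2 * mu by rewrite /d /eta; field.
have Emu : mu - eta = eta by rewrite /eta; field.
set Kc := ext_bound eta core_size.
have Kc0 : (0 < Kc)%N by exact: ext_bound_gt0.
set Kt := ext_bound eta triple_size.
have Kt0 : (0 < Kt)%N by exact: ext_bound_gt0.
set Kp := regular_bound eta pair_size.
have Kp0 : (0 < Kp)%N by exact: regular_bound_gt0.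
have cS : (7 * Kc * Kt * Kp * s)%:R <= mu * #|S|%:R := cardS.
have muS : mu * #|S|%:R <= 1 / 100 * #|S|%:R by rewrite ler_wpM2r.
have S_le : 0 <= #|S|%:R :> R by [].
have part c : (c <= Kc * Kt * Kp * s)%N -> c%:R <= mu / 7 * #|S|%:R.
  rewrite -(ler_nat R) => le_c; apply: le_trans le_c _.
  move: cS; have -> : (7 * Kc * Kt * Kp * s = 7 * (Kc * Kt * Kp * s))%N by rewrite !mulnA.
  by rewrite natrM; lra.
have toN c (X : {set V}) : c%:R <= mu / 7 * #|S|%:R -> mu / 7 * #|S|%:R <= #|X|%:R -> (c <= #|X|)%N.
  by move=> h1 h2; rewrite -(ler_nat R); exact: le_trans h2.
have leKp : (Kp * s <= Kc * Kt * Kp * s)%N.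
  by rewrite leq_mul2r leq_pmull ?orbT // muln_gt0 Kc0.
have leKt s1 : (s1 <= Kp * s)%N -> (Kt * s1 <= Kc * Kt * Kp * s)%N.
  move=> h; apply: leq_trans (leq_mul (leqnn Kt) h) _.
  by rewrite mulnA leq_mul2r leq_mul2r leq_pmull ?orbT.
have leKc s1 s2 : (s1 <= Kp * s)%N -> (s2 <= Kt * s1)%N -> (Kc * s2 <= Kc * Kt * Kp * s)%N.
  clear -Kc Kt Kp; move: Kc Kt Kp => a b c h1 h2; rewrite -!mulnA leq_mul2l; apply/orP; right.
  by apply: leq_trans h2 _; rewrite leq_mul2l h1 orbT.
have SS : mu / 7 * #|S|%:R <= #|S|%:R.
  by rewrite ler_piMl //; move: mu_le; lra.
have cSp : (Kp * s <= #|S|)%N by apply: toN SS; exact: part.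
have [s1 [A1 [B1 [s_s1 s1_K sA1 sB1 [cA1 cB1 reg1]]]]] :=
  regular_pair e_sym eta_gt0 (isT : 1 < pair_size)%N s_gt0 d0 cSp cSp (ecount_ge e_sym degSd).
have s10 := leq_trans s_gt0 s_s1.
have A10 : (0 < #|A1|)%N by rewrite cA1 muln_gt0.
have B10 : (0 < #|B1|)%N by rewrite cB1 muln_gt0.
pose dn := density R e.
pose X1 := [set v in S | (mu <= dn A1 v) && (mu <= dn B1 v)].
have cX1 : mu / 7 * #|S|%:R <= #|X1|%:R.
  (* Outside [X1] one density is below [mu] and the other at most 1, while the average of the sum is
     at least [2 * d = 16 / 15 + 4 * mu]. *)
  have := exceptional_card (f := fun v => dn A1 v + dn B1 v) (S := S) (X := X1)
    (a := 1 + mu) (b := 1) (c := 2 * d) _ _ _.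
  have -> : 2 * d - (1 + mu) = 1 / 15 + 3 * mu by rewrite /d; field.
  move=> H; apply: le_trans (_ : (1 / 15 + 3 * mu) * #|S|%:R <= _).
    rewrite ler_wpM2r //; move: mu0; lra.
  rewrite -[leRHS]mul1r; apply: H.
  - by apply/subsetP => v; rewrite inE => /andP[].
  - move=> v vS; have a1 : dn A1 v <= 1 := density_le1 R e A1 v.
    have b1 : dn B1 v <= 1 := density_le1 R e B1 v.
    rewrite inE vS /=.
    by case: (lerP mu (dn A1 v)) => h1 /=; case: (lerP mu (dn B1 v)) => h2 /=; move: a1 b1 h1 h2 mu0; lra.
  - rewrite big_split /= mulrDl mul1r mulrDl; apply: lerD; apply: sum_density => //.
have X1A : {in X1, forall x, mu * #|A1|%:R <= #|nbr e A1 x|%:R}.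
  by move=> x; rewrite inE => /andP[_ /andP[]]; rewrite /dn !density_ge.
have X1B : {in X1, forall x, mu * #|B1|%:R <= #|nbr e B1 x|%:R}.
  by move=> x; rewrite inE => /andP[_ /andP[]]; rewrite /dn !density_ge.
have cKX1 : (Kt * s1 <= #|X1|)%N by apply: toN cX1; apply: part; exact: leKt.
have cKA1 : (Kt * s1 <= #|A1|)%N by rewrite cA1 leq_mul2r /pair_size -/Kt !leqW ?orbT.
have cKB1 : (Kt * s1 <= #|B1|)%N by rewrite cB1 leq_mul2r /pair_size -/Kt !leqW ?orbT.
have [s2 [A [B [B' [C [sA sB _ sC [/andP[s12 s2_K] [cA cB _ cC] rA rB _]]]]]]] :=
  regular_extension e_sym eta_gt0 (isT : 1 < triple_size)%N s10 mu0 mu0 mu0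
    cKA1 cKB1 cKB1 cKX1 X1A X1B X1B.
rewrite -/Kt in s2_K; rewrite Emu in rA rB.
have rAB : lower_regular e A B eta s2.
  apply: lower_regular_sub sA sB s12 _; apply: lower_regular_le reg1.
  by rewrite E5 /eta; move: mu0; lra.
have s_s2 := leq_trans s_s1 s12; have s20 := leq_trans s_gt0 s_s2.
have big (W : {set V}) : (triple_size * s2 <= #|W|)%N -> (Kc * s2 <= #|W|)%N.
  by apply: leq_trans; rewrite leq_mul2r /triple_size -/Kc !leqW ?orbT.
have pos (W : {set V}) : (triple_size * s2 <= #|W|)%N -> (0 < #|W|)%N.
  by apply: leq_trans; rewrite muln_gt0.
have bigX (W : {set V}) : mu / 7 * #|S|%:R <= #|W|%:R -> (Kc * s2 <= #|W|)%N.
  by apply: toN; apply: part; apply: leKc s2_K.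
have [A0 B0 C0] := And3 (pos _ cA) (pos _ cB) (pos _ cC).
have sAS := subset_trans sA sA1; have sBS := subset_trans sB sB1.
have sCS : C \subset S.
  by apply: subset_trans sC _; apply/subsetP => v; rewrite inE => /andP[].
pose X4 := [set v in S | [&& mu <= dn A v, mu <= dn B v & mu <= dn C v]].
pose Y (P Q : {set V}) := [set v in S | (4 / 5 + mu <= dn P v) && (mu <= dn Q v)].
have Ycase (P Q : {set V}) : lower_regular e P Q eta s2 ->
    (triple_size * s2 <= #|P|)%N -> (triple_size * s2 <= #|Q|)%N ->
    mu / 7 * #|S|%:R <= #|Y P Q|%:R -> exists2 T : {set V}, (13 <= #|T|)%N & clique e T.
  move=> rPQ cP cQ cY; apply: (three_case s_s2 rPQ (big _ cP) (big _ cQ) (bigX _ cY)).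
    by move=> v; rewrite inE => /andP[_ /andP[]]; rewrite /dn !density_ge // pos.
  by move=> v; rewrite inE => /andP[_ /andP[_]]; rewrite /dn density_ge // pos.
have [c4|c4] := lerP (mu / 7 * #|S|%:R) #|X4|%:R.
  apply: (four_case s_s2 rAB rA rB (big _ cA) (big _ cB) (big _ cC) (bigX _ c4)).
  - by move=> v; rewrite inE => /andP[_ /and3P[h _ _]]; move: h; rewrite /dn density_ge.
  - by move=> v; rewrite inE => /andP[_ /and3P[_ h _]]; move: h; rewrite /dn density_ge.
  - by move=> v; rewrite inE => /andP[_ /and3P[_ _ h]]; move: h; rewrite /dn density_ge.
have [|cAB] := lerP (mu / 7 * #|S|%:R) #|Y A B|%:R; first exact: Ycase.
have [|cBA] := lerP (mu / 7 * #|S|%:R) #|Y B A|%:R.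
  by apply: Ycase => //; exact: lower_regularC.
have [|cAC] := lerP (mu / 7 * #|S|%:R) #|Y A C|%:R; first exact: Ycase.
have [|cCA] := lerP (mu / 7 * #|S|%:R) #|Y C A|%:R.
  by apply: Ycase => //; exact: lower_regularC.
have [|cBC] := lerP (mu / 7 * #|S|%:R) #|Y B C|%:R; first exact: Ycase.
have [|cCB] := lerP (mu / 7 * #|S|%:R) #|Y C B|%:R.
  by apply: Ycase => //; exact: lower_regularC.
(* All seven sets are now smaller than [mu / 7 * |S|], so their union [X] has fewer than [mu * |S|]
   vertices, whereas averaging the three densities gives [3 * mu * |S| <= 2 * |X|]. *)
exfalso.
pose X := X4 :|: Y A B :|: Y B A :|: Y A C :|: Y C A :|: Y B C :|: Y C B.
have cX : #|X|%:R <= #|X4|%:R + #|Y A B|%:R + #|Y B A|%:R + #|Y A C|%:R + #|Y C A|%:R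
    + #|Y B C|%:R + #|Y C B|%:R :> R.
  rewrite -!natrD ler_nat /X.
  do 6![apply: leq_trans (leq_of_leqif (leq_card_setU _ _)) _; rewrite leq_add2r].
  by [].
have := exceptional_card (f := fun v => dn A v + dn B v + dn C v) (S := S) (X := X)
    (a := 8 / 5 + 3 * mu) (b := 2) (c := 3 * d) _ _ _.
have -> : 3 * d - (8 / 5 + 3 * mu) = 3 * mu by rewrite /d; field.
move=> H; have : 3 * mu * #|S|%:R <= 2 * #|X|%:R.
  apply: H.
  - by apply/subsetP => v; rewrite !inE; case: (v \in S).
  - move=> v vS; have := density_le1 R e A v; have := density_le1 R e B v.
    have := density_le1 R e C v; rewrite -/(dn A v) -/(dn B v) -/(dn C v) => c1 b1 a1.
    by rewrite !inE vS /=; exact: three_density_sum.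
  - have -> : 3 * d * #|S|%:R = d * #|S|%:R + d * #|S|%:R + d * #|S|%:R by ring.
    by rewrite !big_split /=; apply: lerD; [apply: lerD|]; apply: sum_density.
have muS0 : 0 < mu * #|S|%:R.
  by apply: lt_le_trans cS; rewrite ltr0n 4!muln_gt0 Kc0 Kt0 Kp0.
by move: cX c4 cAB cBA cAC cCA cBC cCB muS0; lra.
Qed.

End Main.

(** * Degrees, triangles and copies *)

(** [S] maximises [F S], the ordered pair count minus [c * |S| ^ 2]. Deleting [v] cannot raise [F],
    which gives degree at least [c * |S| - c / 2]; and [g * |V| ^ 2 <= F S <= |S| ^ 2] bounds the
    size of [S] from below. *)
Lemma min_degree_subset (R : archiRealFieldType) (V : finType) (e : rel V) (c g : R) :
  symmetric e -> 0 <= c <= 2 -> 0 <= g <= 1 ->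
  (c + g) * #|V|%:R ^+ 2 <= (ecount e [set: V] [set: V])%:R ->
  exists S : {set V}, g * #|V|%:R <= #|S|%:R /\
    {in S, forall v, c * #|S|%:R - 1 <= #|nbr e S v|%:R}.
Proof.
move=> e_sym /andP[c0 c2] /andP[g0 g1] dense.
pose F (S : {set V}) : R := (ecount e S S)%:R - c * #|S|%:R ^+ 2.
have [S _ maxS] := @arg_maxP _ R _ [set: V] predT F isT.
exists S; split.
  have le1 : g * #|V|%:R ^+ 2 <= F S.
    apply: le_trans (maxS setT isT); rewrite /F cardsT; move: dense; lra.
  have le2 : F S <= #|S|%:R ^+ 2.
    rewrite /F lerBlDr; apply: le_trans (_ : (#|S| * #|S|)%:R <= _).
      by rewrite ler_nat ecount_le.
    by rewrite natrM -expr2 lerDl mulr_ge0 // exprn_ge0.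
  rewrite -(ler_pXn2r (n := 2)) ?nnegrE ?mulr_ge0 // exprMn.
  apply: le_trans (le_trans le1 le2); rewrite ler_wpM2r ?exprn_ge0 //.
  by rewrite expr2 ler_piMl.
move=> v vS; have sv : [set v] \subset S by rewrite sub1set.
have deg1 (T : {set V}) : ecount e [set v] T = #|nbr e T v| by rewrite /ecount big_set1.
have E1 : ecount e S S = (#|nbr e S v| + ecount e (S :\ v) S)%N.
  by rewrite (ecount_split_l e S sv) deg1.
have E2 : ecount e (S :\ v) S = (#|nbr e (S :\ v) v| + ecount e (S :\ v) (S :\ v))%N.
  by rewrite (ecount_split_r e _ sv) ecountC // deg1.
have le3 : (#|nbr e (S :\ v) v| <= #|nbr e S v|)%N.
  by apply: subset_leq_card; apply/subsetP => y; rewrite !inE => /andP[/andP[_ ->] ->].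
have : F (S :\ v) <= F S := maxS (S :\ v) isT.
rewrite /F E1 E2.
have -> : #|S|%:R = #|S :\ v|%:R + 1 :> R by rewrite (cardsD1 v S) vS natrD addrC.
move: le3; rewrite -(ler_nat R) !natrD.
move: #|nbr e (S :\ v) v|%:R #|nbr e S v|%:R (ecount e _ _)%:R #|S :\ v|%:R => a b f k.
clear -c2 => h1 h2.
have : c * (k + 1) ^+ 2 - c * k ^+ 2 <= a + b by move: h2; lra.
by rewrite sqrrD1 mulrDr mulrDr mulrnAr; move: h1; lra.
Qed.

Definition indep (V : finType) (e : rel V) (I : {set V}) : bool :=
  [forall x in I, forall y in I, ~~ e x y].

Lemma indepP (V : finType) (e : rel V) (I : {set V}) :
  reflect {in I &, forall x y, ~~ e x y} (indep e I).
Proof.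
apply: (iffP forall_inP) => [H x y xI yI|H x xI]; first by have /forall_inP := H x xI; exact.
by apply/forall_inP => y yI; exact: H.
Qed.

(* In a triangle-free graph neighbourhoods are independent, so the closed
   neighbourhoods of a maximal independent set cover at most [a * a + a]
   vertices. *)
Lemma triangle_in_large_set (V : finType) (e : rel V) (W : {set V}) (a : nat) :
  symmetric e -> irreflexive e ->
  (forall I : {set V}, I \subset W -> indep e I -> (#|I| <= a)%N) -> (a * a + a < #|W|)%N ->
  exists T : {set V}, [/\ T \subset W, #|T| = 3 & clique e T].
Proof.
move=> e_sym e_irr Ha cW.
have nb_le (x : V) : nbr e W x \subset W by apply/subsetP => y; rewrite inE => /andP[].
have [/exists_inP[x xW]|] := boolP [exists x in W, ~~ indep e (nbr e W x)].
  rewrite /indep negb_forall_in => /exists_inP[y]; rewrite inE => /andP[yW xy].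
  rewrite negb_forall_in => /exists_inP[z]; rewrite inE negbK => /andP[zW xz] yz.
  exists [set x; y; z]; split.
  - by apply/subsetP => t; rewrite !inE => /orP[/orP[]|] /eqP->.
  - have neq u v : e u v -> v != u by apply: contraTneq => ->; rewrite e_irr.
    by rewrite setUC cardsU1 cards2 !inE negb_or (neq x z) // (neq y z) // (eq_sym x) neq.
  - apply/cliqueP => t u; rewrite !inE.
    by move=> /orP[/orP[]|] /eqP-> /orP[/orP[]|] /eqP->; rewrite ?eqxx // e_sym // e_sym.
rewrite negb_exists_in => /forall_inP indN; exfalso.
pose P (I : {set V}) := (I \subset W) && indep e I.
have P0 : P set0 by rewrite /P sub0set; apply/indepP => x y; rewrite inE.
have [I /andP[sI indI] maxI] := arg_maxnP (fun I : {set V} => #|I|) P0.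
have cov : W \subset I :|: \bigcup_(x in I) nbr e W x.
  apply/subsetP => y yW; rewrite inE; have [//|yI] /= := boolP (y \in I).
  apply/bigcupP; apply/exists_inP; rewrite -[X in is_true X]negbK negb_exists_in.
  apply/negP => /forall_inP noN.
  have nadj x : x \in I -> ~~ e x y by move=> xI; have := noN x xI; rewrite inE yW.
  have : P (y |: I).
    rewrite /P subUset sub1set yW sI; apply/indepP => u v; rewrite !inE.
    move=> /orP[/eqP->|uI] /orP[/eqP->|vI]; first by rewrite e_irr.
    - by rewrite e_sym nadj.
    - exact: nadj.
    - exact: (indepP _ _ indI).
  by move=> /maxI /=; rewrite cardsU1 yI add1n ltnn.
have cI := Ha I sI indI.
have := subset_leq_card cov; rewrite leqNgt => /negP; apply.
apply: leq_ltn_trans cW; apply: leq_trans (leq_of_leqif (leq_card_setU _ _)) _.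
rewrite addnC leq_add //; apply: leq_trans (_ : #|I| * a <= _)%N; last by rewrite leq_mul2r cI orbT.
rewrite -sum_nat_const.
have : forall x, x \in I -> (#|nbr e W x| <= a)%N.
  by move=> x xI; apply: Ha (nb_le x) _; have := indN x (subsetP sI _ xI); rewrite negbK.
move=> Hd; apply: leq_trans (_ : \sum_(x in I) #|nbr e W x| <= _)%N; last exact: leq_sum.
elim/big_rec2: _ => [|x k U _ IH]; first by rewrite cards0.
exact: leq_trans (leq_of_leqif (leq_card_setU _ _)) (leq_add (leqnn _) IH).
Qed.

Lemma injection_into_set (V : finType) (U : {set V}) (n : nat) : (n <= #|U|)%N ->
  exists2 f : 'I_n -> V, injective f & forall i, f i \in U.
Proof.
move=> le_n; exists (fun i => enum_val (widen_ord le_n i)).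
  by move=> i j /enum_val_inj/(congr1 val)/= /val_inj.
by move=> i; exact: enum_valP.
Qed.

Lemma clique_imset (U V : finType) (e1 : rel U) (e : rel V) (f : U -> V) (T : {set U}) :
  irreflexive e -> (forall x y, e1 x y -> e (f x) (f y)) -> clique e1 T ->
  clique e (f @: T) /\ #|f @: T| = #|T|.
Proof.
move=> e_irr Hf /cliqueP cT; split.
  apply/cliqueP => _ _ /imsetP[x xT ->] /imsetP[y yT ->] fxy.
  by apply/Hf/cT => //; apply: contraNneq fxy => ->.
apply: card_in_imset => x y xT yT Exy; apply/eqP; apply/negPn/negP => /(cT _ _ xT yT)/Hf.
by rewrite Exy e_irr.
Qed.

(** Taking [n] vertices from [j] disjoint copies of [W] creates no new cliques and multiplies
    independence by at most [j]. With [t = 5], a linear set free of 5-cliques would thus bound the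
    inverse Ramsey number by [j * a]. *)
Lemma disjoint_copies (V : finType) (e : rel V) (W : {set V}) (a j n t : nat) :
  symmetric e -> irreflexive e ->
  (forall I : {set V}, I \subset W -> indep e I -> (#|I| <= a)%N) ->
  (forall T : {set V}, T \subset W -> clique e T -> #|T| <> t) -> (n <= #|W| * j)%N ->
  exists e1 : rel 'I_n, [/\ symmetric e1, irreflexive e1,
    (forall T, clique e1 T -> #|T| <> t) & (forall I, indep e1 I -> (#|I| <= j * a)%N)].
Proof.
move=> e_sym e_irr Ha Ht le_n.
have [f f_inj fW] : exists2 f : 'I_n -> V * 'I_j, injective f &
    forall i, f i \in setX W [set: 'I_j].
  by apply: injection_into_set; rewrite cardsX cardsT card_ord.
have fW1 i : (f i).1 \in W by have := fW i; rewrite inE => /andP[].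
exists (fun i k => ((f i).2 == (f k).2) && e (f i).1 (f k).1); split.
- by move=> i k; rewrite eq_sym e_sym.
- by move=> i; rewrite e_irr andbF.
- move=> T cT; have [||cT' ET'] := @clique_imset _ _ _ e (fun i => (f i).1) T _ _ cT => //.
    by move=> i k /andP[].
  rewrite -ET'; apply: Ht => //; by apply/subsetP => _ /imsetP[i _ ->].
move=> I /indepP indI; rewrite -sum1_card (partition_big (fun i => (f i).2) predT) //=.
rewrite -[X in (_ <= X * _)%N]card_ord -sum_nat_const; apply: leq_sum => k _.
rewrite sum1_card -(@card_in_imset _ _ (fun i => (f i).1)); last first.
  move=> x y; rewrite !unfold_in => /andP[_ /eqP Ex] /andP[_ /eqP Ey] Exy; apply: f_inj.
  by rewrite [LHS]surjective_pairing [RHS]surjective_pairing Ex Ey Exy.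
apply: Ha; first by apply/subsetP => _ /imsetP[i _ ->].
apply/indepP => _ _ /imsetP[x + ->] /imsetP[y + ->].
rewrite !unfold_in => /andP[xI /eqP Ex] /andP[yI /eqP Ey].
by have := indI _ _ xI yI; rewrite Ex Ey eqxx.
Qed.

(** * A [K_5]-free graph with small independence number *)

Section RandomGraphs.
Local Open Scope nat_scope.

(** Independence of the colours, cleared of denominators: all of [P] is coloured in [Q] with
    probability [(|Q| / k) ^ |P|]. *)
Lemma card_ffun_constrained (I : finType) (k : nat) (P : {set I}) (Q : pred 'I_k) :
  #|[set c : {ffun I -> 'I_k} | [forall p in P, c p \in Q]]| * k ^ #|P| = #|Q| ^ #|P| * k ^ #|I|.
Proof.
pose F (p : I) : pred 'I_k := if p \in P then Q else predT.
have -> : #|[set c : {ffun I -> 'I_k} | [forall p in P, c p \in Q]]| =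
    #|(family F : simpl_pred {ffun I -> 'I_k})|.
  apply: eq_card => c; rewrite inE; apply/forall_inP/familyP => [H p|H p pP].
    by rewrite /F; case: ifP => [pP|]; [exact: H | rewrite inE].
  by have := H p; rewrite /F pP.
rewrite card_family foldrE big_image /= (bigID (mem P)) /=.
have -> : \prod_(i in P) #|F i| = #|Q| ^ #|P|.
  by rewrite -prod_nat_const; apply: eq_bigr => i iP; rewrite /F iP.
have -> : \prod_(i | i \notin P) #|F i| = k ^ #|~: P|.
  rewrite -prod_nat_const; apply: eq_big => [i|i iP]; first by rewrite inE.
  by rewrite /F (negbTE iP) card_ord.
by rewrite -mulnA -expnD [_ + #|P|]addnC cardsC.
Qed.

Definition pairs (V : finType) (T : {set V}) : {set {set V}} :=
  [set p : {set V} | p \subset T & #|p| == 2].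

(** A first moment, multiplied out: [t]-cliques and independent [t]-sets are the two choices of [Q]
    that serve below. *)
Lemma sum_ffun_constrained (V : finType) (k t : nat) (Q : pred 'I_k) :
  (\sum_(c : {ffun {set V} -> 'I_k})
     #|[set T : {set V} | (#|T| == t) && [forall p in pairs T, c p \in Q]]|) * k ^ 'C(t, 2)
  <= #|V| ^ t * #|Q| ^ 'C(t, 2) * #|{ffun {set V} -> 'I_k}|.
Proof.
have -> : \sum_(c : {ffun {set V} -> 'I_k})
     #|[set T : {set V} | (#|T| == t) && [forall p in pairs T, c p \in Q]]|
   = \sum_(T : {set V} | #|T| == t)
     #|[set c : {ffun {set V} -> 'I_k} | [forall p in pairs T, c p \in Q]]|.
  under eq_bigr do rewrite -sum1_card big_mkcond /=.
  rewrite exchange_big /= [RHS]big_mkcond; apply: eq_bigr => T _ /=.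
  case ET: (#|T| == t); last by rewrite big1 // => c _; rewrite inE ET.
  by rewrite -sum1_card [RHS]big_mkcond; apply: eq_bigr => c _; rewrite !inE ET.
rewrite big_distrl /=.
have H (T : {set V}) : #|T| == t ->
    #|[set c : {ffun {set V} -> 'I_k} | [forall p in pairs T, c p \in Q]]| * k ^ 'C(t, 2)
    = #|Q| ^ 'C(t, 2) * k ^ #|{set V}|.
  move=> /eqP ET; have EP : #|pairs T| = 'C(t, 2) by rewrite cards_draws ET.
  by have := card_ffun_constrained (pairs T) Q; rewrite EP.
rewrite (eq_bigr _ H) sum_nat_const -mulnA leq_mul //; last by rewrite card_ffun card_ord.
have -> : #|[pred T : {set V} | #|T| == t]| = 'C(#|V|, t).
  by rewrite -card_draws; apply: eq_card => T; rewrite !inE.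
apply: leq_trans (_ : #|V| ^_ t <= _).
  by rewrite -bin_ffact leq_pmulr // fact_gt0.
elim: t {H} => [|t IH]; first by rewrite ffactn0 expn0.
by rewrite ffactnSr expnSr leq_mul // leq_subr.
Qed.

(** A uniform colouring stands for the random graph: an edge is a pair with one distinguished colour
    among [k.+1], so that probabilities become exact counts. *)
Definition colour_rel (V : finType) (k : nat) (c : {ffun {set V} -> 'I_k.+1}) : rel V :=
  fun x y => (x != y) && (c [set x; y] == ord0).

Lemma colour_rel_sym (V : finType) (k : nat) (c : {ffun {set V} -> 'I_k.+1}) :
  symmetric (colour_rel c).
Proof. by move=> x y; rewrite /colour_rel eq_sym setUC. Qed.

Lemma colour_rel_irr (V : finType) (k : nat) (c : {ffun {set V} -> 'I_k.+1}) :
  irreflexive (colour_rel c).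
Proof. by move=> x; rewrite /colour_rel eqxx. Qed.

(* Each pair is an edge with probability [1 / k]; the weighted first moment of
   5-cliques and of independent sets of size [a] is at most [n]. *)
Lemma random_graph (V : finType) (n k1 a : nat) : 0 < n -> #|V| = 2 * n ->
  64 * n ^ 4 <= k1.+1 ^ 10 -> 4 * (2 * n) ^ a * k1 ^ 'C(a, 2) <= k1.+1 ^ 'C(a, 2) ->
  exists e : rel V, [/\ symmetric e, irreflexive e,
    #|[set T : {set V} | (#|T| == 5) && clique e T]| <= n &
    forall I : {set V}, indep e I -> #|I| != a].
Proof.
move=> n0 cV H1 H2; set k := k1.+1 in H1 H2.
pose K (c : {ffun {set V} -> 'I_k}) :=
  #|[set T : {set V} | (#|T| == 5) && [forall p in pairs T, c p \in pred1 ord0]]|.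
pose J (c : {ffun {set V} -> 'I_k}) :=
  #|[set T : {set V} | (#|T| == a) && [forall p in pairs T, c p \in predC1 ord0]]|.
have sK := @sum_ffun_constrained V k 5 (pred1 ord0).
have sJ := @sum_ffun_constrained V k a (predC1 ord0).
rewrite -/(\sum_c K c) card1 exp1n muln1 cV in sK.
rewrite -/(\sum_c J c) cardC1 card_ord cV in sJ.
have M0 : 0 < #|{ffun {set V} -> 'I_k}| by rewrite card_ffun card_ord expn_gt0.
have [M EM] : exists M, #|{ffun {set V} -> 'I_k}| = M by eexists.
rewrite EM in sK sJ M0.
have {sK} hK : 2 * (\sum_c K c) <= n * M.
  rewrite -(leq_pmul2r (m := 32 * n ^ 4)); last by rewrite muln_gt0 expn_gt0 n0.
  have h := leq_trans (leq_mul (leqnn (\sum_c K c)) H1) sK.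
  have E : (2 * n) ^ 5 = 32 * n ^ 4 * n by rewrite expnMn [n ^ 5]expnSr mulnA.
  move: h; rewrite E; move: (\sum_c K c) (n ^ 4) => x z; clear; nia.
have {sJ} hJ : 4 * (\sum_c J c) <= M.
  have k0 : 0 < k ^ 'C(a, 2) by rewrite expn_gt0.
  rewrite -(leq_pmul2r k0) -mulnA.
  apply: leq_trans (leq_mul (leqnn 4) sJ) _.
  move: H2; move: ((2 * n) ^ a) (k1 ^ 'C(a, 2)) (k ^ 'C(a, 2)) => x y z H2.
  by rewrite [M * z]mulnC !mulnA leq_mul2r H2 orbT.
(* The averages of [K] and [J] are at most [n / 2] and [1 / 4]. The weight [2 * n] makes a single
   independent set exceed the bound [n], so [J c] must vanish. *)
have [c Hc] : exists c, K c + 2 * n * J c <= n.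
  apply/existsP; rewrite -[X in is_true X]negbK negb_exists; apply/negP => /forallP all_gt.
  have : \sum_(c : {ffun {set V} -> 'I_k}) n.+1 <= \sum_c (K c + 2 * n * J c).
    by apply: leq_sum => c _; rewrite ltnNge all_gt.
  rewrite big_split /= -big_distrr /= sum_nat_const EM.
  move: hK hJ M0 n0; move: (\sum_c K c) (\sum_c J c) => x y; clear.
  by rewrite mulnS; nia.
have J0 : J c = 0.
  by apply/eqP; rewrite -leqn0 leqNgt; apply/negP => Jc; move: Hc n0 Jc; clear; nia.
exists (colour_rel c); split; [exact: colour_rel_sym | exact: colour_rel_irr | |].
  apply: leq_trans (_ : K c <= n); last by move: Hc; rewrite J0; clear; lia.
  apply: subset_leq_card; apply/subsetP => T; rewrite !inE => /andP[-> /cliqueP cT] /=.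
  apply/forall_inP => p; rewrite [p \in _]inE => /andP[sp /cards2P[x [y [xy Ep]]]].
  move: sp; rewrite Ep subUset !sub1set => /andP[xT yT].
  by have := cT _ _ xT yT xy; rewrite /colour_rel inE => /andP[].
move=> I /indepP indI; apply/negP => cI; move/eqP: J0; rewrite /J cards_eq0 => /eqP/setP/(_ I).
rewrite !inE cI /= => /negbT/negP; apply; apply/forall_inP => p.
rewrite [p \in _]inE => /andP[sp /cards2P[x [y [xy Ep]]]].
move: sp; rewrite Ep subUset !sub1set => /andP[xI yI].
by have := indI _ _ xI yI; rewrite /colour_rel xy.
Qed.

Lemma indep_sub (V : finType) (e : rel V) (I J : {set V}) :
  J \subset I -> indep e I -> indep e J.
Proof.
by move=> /subsetP sJ /indepP H; apply/indepP => x y xJ yJ; apply: H; exact: sJ.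
Qed.

(** One vertex is removed from every 5-clique, at most [n] out of [2 * n]. An independent set larger
    than [a] would contain one of size exactly [a]. *)
Lemma deletion (V : finType) (e : rel V) (n a : nat) :
  symmetric e -> irreflexive e -> 2 * n <= #|V| ->
  #|[set T : {set V} | (#|T| == 5) && clique e T]| <= n ->
  (forall I : {set V}, indep e I -> #|I| != a) ->
  exists e1 : rel 'I_n, [/\ symmetric e1, irreflexive e1,
    (forall T, clique e1 T -> #|T| <> 5) & (forall I, indep e1 I -> #|I| <= a)].
Proof.
move=> e_sym e_irr cV; set Z := [set T | _] => cZ noI.
pose D : {set V} := \bigcup_(T in Z) (if [pick x in T] is Some x then [set x] else set0).
have cD : #|D| <= n.
  apply: leq_trans cZ; rewrite -[#|Z|]sum1_card /D.
  elim/big_rec2: _ => [|T x U _ IH]; first by rewrite cards0.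
  apply: leq_trans (leq_of_leqif (leq_card_setU _ _)) (leq_add _ IH).
  by case: pickP => [y _|_]; rewrite ?cards1 ?cards0.
have cU : n <= #|~: D| by rewrite cardsCs setCK; move: cV cD; clear; lia.
have [f f_inj fU] := injection_into_set cU.
exists (fun i j => e (f i) (f j)); split.
- by move=> i j; exact: e_sym.
- by move=> i; exact: e_irr.
- move=> T cT ET.
  have [//|cT' ET'] := @clique_imset _ _ _ e f T e_irr _ cT.
  have TZ : f @: T \in Z by rewrite inE ET' ET eqxx.
  have : [pick x in f @: T] != None.
    case: pickP => // none; have : #|f @: T| = 0 by apply: eq_card0.
    by rewrite ET' ET.
  case E: [pick x in f @: T] => [x|//] _.
  have xT : x \in f @: T by move: E; case: pickP => // y yT [<-].
  have xD : x \in D by apply/bigcupP; exists (f @: T); rewrite // E inE.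
  by case/imsetP: xT => i _ Ex; have := fU i; rewrite inE -Ex xD.
- move=> I indI; rewrite leqNgt; apply/negP => lt_aI.
  have cfI : #|f @: I| = #|I| by apply: card_imset.
  have indf : indep e (f @: I).
    apply/indepP => _ _ /imsetP[x xI ->] /imsetP[y yI ->].
    exact: (indepP _ _ indI).
  have [J [sJ cJ]] : exists J : {set V}, J \subset f @: I /\ #|J| = a.
    have [g g_inj gI] := @injection_into_set _ (f @: I) a (ltnW (leq_trans lt_aI (eq_leq (esym cfI)))).
    exists (g @: [set: 'I_a]); rewrite card_imset // cardsT card_ord; split=> //.
    by apply/subsetP => _ /imsetP[i _ ->].
  by have := noI J (indep_sub sJ indf); rewrite cJ eqxx.
Qed.

(** * Numerical estimates for the random graph *)

Lemma bernoulli (x m : nat) : x ^ m.+1 + m.+1 * x ^ m <= x.+1 ^ m.+1.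
Proof.
elim: m => [|m IH]; first by rewrite !expn1 expn0; lia.
rewrite [x.+1 ^ _]expnS; apply: leq_trans (leq_mul (leqnn _) IH).
rewrite [x ^ m.+2]expnS [x ^ m.+1]expnS; move: (x ^ m) => y; nia.
Qed.

Lemma half_power (k : nat) : 2 * k ^ k.+1 <= k.+1 ^ k.+1.
Proof.
apply: leq_trans (bernoulli k k); rewrite [k ^ k.+1]expnS; move: (k ^ k) => y; nia.
Qed.

(** This absorbs a power of a logarithm: [l <= d * 2 ^ (l %/ d)], raised to the power [d]. *)
Lemma expn_le_exp2 (d l : nat) : 0 < d -> l ^ d <= d ^ d * 2 ^ l.
Proof.
move=> d0; apply: leq_trans (_ : (d * 2 ^ (l %/ d)) ^ d <= _).
  rewrite leq_exp2r //; apply: leq_trans (_ : d * (l %/ d).+1 <= _).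
    by rewrite mulnC ltnW // ltn_ceil.
  by rewrite leq_mul2l ltn_expl ?orbT.
by rewrite expnMn -expnM leq_mul2l leq_exp2l // leq_trunc_div orbT.
Qed.

(** With [k = k1.+1], the choice [a = 2 k l + 1] makes ['C(a, 2)] equal to [k l a]. All pairs of an
    [a]-set are then non-edges with probability at most [1 / 2 ^ (l a)], while
    [4 (2 n) ^ a <= (8 n) ^ a <= 2 ^ (l a)]. *)
Lemma random_parameters (n k1 l : nat) : 0 < n -> 0 < l -> 8 * n <= 2 ^ l ->
  4 * (2 * n) ^ (2 * k1.+1 * l).+1 * k1 ^ 'C((2 * k1.+1 * l).+1, 2)
  <= k1.+1 ^ 'C((2 * k1.+1 * l).+1, 2).
Proof.
move=> n0 l0 ln; set k := k1.+1; set a := (2 * k * l).+1.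
have EC : 'C(a, 2) = k * (l * a).
  rewrite bin2 /a /=; set b := 2 * k * l.
  have -> : b.+1 * b = (k * (l * b.+1)).*2 by rewrite /b -mul2n; lia.
  by rewrite doubleK.
rewrite EC [k ^ _]expnM [k1 ^ _]expnM.
apply: leq_trans (_ : (2 * k1 ^ k) ^ (l * a) <= _); last first.
  by rewrite leq_exp2r ?half_power // muln_gt0 l0.
rewrite [(2 * k1 ^ k) ^ _]expnMn leq_mul2r; apply/orP; right.
rewrite expnM; apply: leq_trans (_ : (8 * n) ^ a <= _); last by rewrite leq_exp2r.
have -> : 8 * n = 4 * (2 * n) by rewrite mulnA.
rewrite [(4 * _) ^ a]expnMn leq_mul2r; apply/orP; right.
by rewrite -[X in X <= _]expn1 leq_exp2l.
Qed.

(** Edge probability of order [n ^ (-2/5)] leaves about [n] 5-cliques to delete and gives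
    independence of order [n ^ (2/5) log n]. The margin between 2/5 and 9/20 pays for the
    logarithm. *)
Lemma sparse_K5_free_graph : exists C : nat, forall n : nat, 0 < n ->
  exists (e : rel 'I_n) (a : nat), [/\ symmetric e, irreflexive e,
    (forall T, clique e T -> #|T| <> 5), (forall I, indep e I -> #|I| <= a) &
    a ^ 20 <= C * n ^ 9].
Proof.
have [c1 Ec1] : exists c, c = 3 ^ 20 by exact: (ex_intro _ _ (erefl (3 ^ 20))).
have [c2 Ec2] : exists c, c = 256 ^ 4 by exact: (ex_intro _ _ (erefl (256 ^ 4))).
have [c3 Ec3] : exists c, c = 20 ^ 20 by exact: (ex_intro _ _ (erefl (20 ^ 20))).
exists (c1 * c2 * (c3 * 16)) => n n0.
(* [k] is the inverse edge probability: [8 * n ^ 2 <= k ^ 5] controls 5-cliques, and minimality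
   bounds [k] from above, hence also the independence number. *)
have exk : exists k, 8 * n ^ 2 <= k ^ 5.
  exists (8 * n ^ 2); rewrite -{1}[8 * n ^ 2]expn1 leq_pexp2l // muln_gt0 expn_gt0 n0 //.
have [k kP kmin] := ex_minnP exk.
have k2 : 1 < k.
  rewrite ltnNge; apply/negP => k1; have : k ^ 5 <= 1 ^ 5 by rewrite leq_exp2r.
  move=> h; have := leq_trans kP h; rewrite exp1n.
  have : 0 < n ^ 2 by rewrite expn_gt0 n0.
  by clear; lia.
case: k k2 kP kmin => // k1 k10 kP kmin.
have k_le : k1.+1 ^ 5 <= 256 * n ^ 2.
  have : ~~ (8 * n ^ 2 <= k1 ^ 5) by apply/negP => /kmin; rewrite ltnn.
  rewrite -ltnNge => /ltnW h.
  apply: leq_trans (_ : (2 * k1) ^ 5 <= _); first by rewrite leq_exp2r //; move: k10; clear; lia.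
  rewrite expnMn; apply: leq_trans (leq_mul (leqnn _) h) _.
  by rewrite mulnA.
pose l := (trunc_log 2 (8 * n)).+1.
have l0 : 0 < l by [].
have n8 : 0 < 8 * n by rewrite muln_gt0 n0.
have /andP[l_lo l_hi] := trunc_log_bounds (isT : 1 < 2) n8.
pose a := (2 * k1.+1 * l).+1.
have H1 : 64 * n ^ 4 <= k1.+1 ^ 10.
  have -> : 64 * n ^ 4 = (8 * n ^ 2) ^ 2 by rewrite expnMn -expnM.
  have -> : k1.+1 ^ 10 = (k1.+1 ^ 5) ^ 2 by rewrite -expnM.
  by rewrite leq_exp2r.
have cV : #|'I_(2 * n)| = 2 * n by rewrite card_ord.
have [e0 [e0_sym e0_irr e0K e0I]] :=
  random_graph n0 cV H1 (random_parameters k1 n0 l0 (ltnW l_hi)).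
have [e [e_sym e_irr eK eI]] := deletion e0_sym e0_irr (eq_leq (esym cV)) e0K e0I.
exists e, a; split=> //.
have a_le : a <= 3 * k1.+1 * l.
  by rewrite /a -!mulnA ltn_mul2r //; move: l0; clear; rewrite muln_gt0 => ->.
apply: leq_trans (_ : (3 * k1.+1 * l) ^ 20 <= _); first by rewrite leq_exp2r.
have k20 : k1.+1 ^ 20 <= c2 * n ^ 8.
  have -> : k1.+1 ^ 20 = (k1.+1 ^ 5) ^ 4 by rewrite -expnM.
  have -> : c2 * n ^ 8 = (256 * n ^ 2) ^ 4 by rewrite expnMn -expnM Ec2.
  by rewrite leq_exp2r.
have l20 : l ^ 20 <= c3 * 16 * n.
  apply: leq_trans (expn_le_exp2 l (isT : 0 < 20)) _; rewrite -Ec3.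
  rewrite -[X in _ <= X]mulnA leq_mul2l; apply/orP; right.
  rewrite /l expnS; apply: leq_trans (leq_mul (leqnn 2) l_lo) _.
  by rewrite mulnA.
rewrite [(3 * _ * l) ^ _]expnMn [(3 * _) ^ _]expnMn -Ec1.
apply: leq_trans (leq_mul (leq_mul (leqnn c1) k20) l20) _.
rewrite [n ^ 9]expnSr; apply: eq_leq.
move: (c3 * 16) (n ^ 8) => w z; clear.
by rewrite -!mulnA; congr (_ * (_ * _)); rewrite mulnCA.
Qed.

End RandomGraphs.

(** This fixes 120 as the number of picks: with [a * a] of order [n ^ (9/10)], the exponents add up
    to 11 + 108 = 119, below 120. *)
Lemma small_common_bound (C a n : nat) : (a ^ 20 <= C * n ^ 9)%N ->
  (n ^ 11 * (2 * (a * a + a)) ^ 120 <= 4 ^ 120 * C ^ 12 * n ^ 119)%N.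
Proof.
move=> Ha; have [->|a0] := posnP a; first by rewrite mul0n addn0 muln0 exp0n // muln0.
have h1 : (2 * (a * a + a) <= 4 * a ^ 2)%N.
  by rewrite -mulnn; move: a0; clear; nia.
have -> : (n ^ 119 = n ^ 11 * n ^ 108)%N by rewrite -expnD.
rewrite [leqRHS]mulnCA leq_mul2l; apply/orP; right.
apply: leq_trans (_ : (4 * a ^ 2) ^ 120 <= _)%N; first by rewrite leq_exp2r.
rewrite expnMn -mulnA leq_mul2l; apply/orP; right.
have -> : ((a ^ 2) ^ 120 = (a ^ 20) ^ 12)%N by rewrite -!expnM.
have -> : (C ^ 12 * n ^ 108 = (C * n ^ 9) ^ 12)%N by rewrite expnMn -expnM.
by rewrite leq_exp2r.
Qed.

Theorem dense_graph_clique (R : archiRealFieldType) (g : R) (C : nat) :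
  0 < g <= 1 / 25 -> exists j N : nat, forall (n : nat) (e : rel 'I_n) (a : nat),
  (N <= n)%N -> symmetric e -> irreflexive e -> (a ^ 20 <= C * n ^ 9)%N ->
  (forall I, indep e I -> (#|I| <= a)%N) ->
  (forall W : {set 'I_n}, (n <= #|W| * j)%N ->
    exists T : {set 'I_n}, [/\ T \subset W, #|T| = 5 & clique e T]) ->
  (8 / 15 + 2 * g) * n%:R ^+ 2 <= (ecount e [set: 'I_n] [set: 'I_n])%:R ->
  exists2 T : {set 'I_n}, (13 <= #|T|)%N & clique e T.
Proof.
move=> /andP[g0 g1]; pose mu := g / 4; pose K := host_size mu.
have K0 : (0 < K)%N by rewrite /K /host_size !(muln_gt0, ext_bound_gt0, regular_bound_gt0).
have mu0 : 0 < mu by rewrite divr_gt0.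
have mu1 : mu <= 1 / 100 by rewrite /mu; lra.
(* Chosen so that [|S| >= g * n] and [mu = g / 4] guarantee
   [host_size mu * (tau * n) <= mu * |S|]. *)
pose tau := g ^+ 2 / 4 / K%:R.
have KR0 : 0 < K%:R :> R by rewrite ltr0n.
have tau0 : 0 < tau by rewrite !divr_gt0 // exprn_gt0.
have Etau : K%:R * tau = g ^+ 2 / 4 by rewrite /tau mulrC divfK // gt_eqF.
have t0 : 0 < (tau / 2) ^+ 120 by rewrite exprn_gt0 // divr_gt0.
have [D ED] : exists D : nat, D = (4 ^ 120 * C ^ 12)%N by exact: (ex_intro _ _ (erefl _)).
(* One summand per use of large [n]: rounding [tau * n] down to [s] loses at most half;
   [D * n ^ 119 < s ^ 120]; and half of the surplus [g] absorbs the [- 1] in the degrees. *)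
pose B : R := 2 / tau + D%:R / (tau / 2) ^+ 120 + 2 / g ^+ 2.
have B1 : 0 <= 2 / tau by rewrite divr_ge0 // ltW.
have B2 : 0 <= D%:R / (tau / 2) ^+ 120 by rewrite divr_ge0 // ltW.
have g20 : 0 < g ^+ 2 by rewrite exprn_gt0.
have B3 : 0 <= 2 / g ^+ 2 by rewrite divr_ge0 // ltW.
exists (Num.bound (2 / tau)), (Num.bound B) => n e a leN e_sym e_irr Ha indI hK5 dense.
have B_n : B < n%:R.
  apply: lt_le_trans (archi_boundP _) _; last by rewrite ler_nat.
  by rewrite /B !addr_ge0.
have n1 : 2 <= tau * n%:R.
  by rewrite mulrC -ler_pdivrMr //; apply: ltW; apply: le_lt_trans B_n; rewrite /B; move: B2 B3; clear; lra.
have n2 : D%:R < (tau / 2) ^+ 120 * n%:R.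
  by rewrite mulrC -ltr_pdivrMr //; apply: le_lt_trans B_n; rewrite /B; move: B1 B3; clear; lra.
have n3 : 2 <= g ^+ 2 * n%:R.
  by rewrite mulrC -ler_pdivrMr //; apply: ltW; apply: le_lt_trans B_n; rewrite /B; move: B1 B2; clear; lra.
have n0 : (0 < n)%N.
  by rewrite lt0n; apply: contraTneq n3 => ->; rewrite mulr0 -ltNge.
have c02 : 0 <= 8 / 15 + g <= 2 by apply/andP; split; move: g0 g1; clear; lra.
have g01 : 0 <= g <= 1 by apply/andP; split; move: g0 g1; clear; lra.
have dense' : (8 / 15 + g + g) * #|'I_n|%:R ^+ 2 <= (ecount e [set: 'I_n] [set: 'I_n])%:R.
  by rewrite card_ord; move: dense; have -> : 8 / 15 + 2 * g = 8 / 15 + g + g by ring.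
have [S [cS degS]] := min_degree_subset e_sym c02 g01 dense'.
rewrite card_ord in cS.
have gS : 2 <= g * #|S|%:R.
  apply: le_trans n3 _; rewrite expr2 -mulrA ler_wpM2l // ltW //.
have degS' : {in S, forall v, (8 / 15 + 2 * mu) * #|S|%:R <= #|nbr e S v|%:R}.
  move=> v vS; apply: le_trans (degS v vS).
  by rewrite /mu; move: gS; move: (#|S|) => k; clear; lra.
pose s := Num.truncn (tau * n%:R).
have /andP[s_lo s_hi] : s%:R <= tau * n%:R < s.+1%:R.
  by apply: truncn_itv; rewrite mulr_ge0 // ltW.
have s_half : tau / 2 * n%:R <= s%:R.
  by move: s_hi n1; rewrite -natr1; clear; lra.
have s0 : (0 < s)%N.
  by rewrite -(ltr_nat R); apply: lt_le_trans s_half; rewrite mulr_gt0 ?divr_gt0 ?ltr0n.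
apply: (@clique_of_min_degree R mu _ e S s (a * a + a)) => //.
- move=> W cW; apply: hK5; rewrite -(ler_nat R) natrM.
  have h : 2 / tau <= (Num.bound (2 / tau))%:R by apply: ltW; exact: archi_boundP.
  apply: le_trans (_ : (tau / 2 * n%:R) * (2 / tau) <= _).
    rewrite mulrAC [tau / 2]mulrC mulrACA mulfV ?gt_eqF // mulVf ?gt_eqF // !mul1r //.
  apply: ler_pM => //; last by apply: le_trans s_half _; rewrite ler_nat.
  by rewrite mulr_ge0 // divr_ge0 // ltW.
- move=> W cW; apply: (triangle_in_large_set e_sym e_irr (a := a)) => // I _.
  exact: indI.
- rewrite card_ord -(ltr_nat R).
  apply: le_lt_trans (_ : (D * n ^ 119)%:R < _).
    by rewrite ler_nat ED; exact: small_common_bound.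
  rewrite natrX; apply: lt_le_trans (_ : (tau / 2 * n%:R) ^+ 120 <= _); last first.
    by rewrite ler_pXn2r ?nnegrE // mulr_ge0 // divr_ge0 // ltW.
  rewrite exprMn [n%:R ^+ 120]exprS mulrA natrM natrX ltr_pM2r //.
  by rewrite exprn_gt0 // ltr0n.
- rewrite -/K natrM; apply: le_trans (_ : K%:R * (tau * n%:R) <= _).
    by rewrite ler_wpM2l.
  rewrite mulrA Etau expr2 /mu; apply: le_trans (_ : g / 4 * (g * n%:R) <= _); last first.
    by rewrite ler_wpM2l // ltW.
  by rewrite le_eqVlt; apply/orP; left; apply/eqP; field.
Qed.

(** * Graphs as relations and the Ramsey-Turan density *)

Section Bridge.
Variable V : finType.
Implicit Types (G : sgraph V) (T I : {set V}).
Local Open Scope nat_scope.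

Definition adj G : rel V := fun x y => [set x; y]%SET \in edges G.

Lemma edges_card G p : p \in edges G -> #|p| = 2.
Proof. by move=> pG; have /forall_inP/(_ p pG)/eqP := svalP G. Qed.

Lemma adj_sym G : symmetric (adj G).
Proof. by move=> x y; rewrite /adj setUC. Qed.

Lemma adj_irr G : irreflexive (adj G).
Proof.
by move=> x; apply/negP => /edges_card; rewrite cards2 eqxx.
Qed.

Lemma indepE G I : independent G I = indep (adj G) I.
Proof.
apply/forall_inP/indepP => [H x y xI yI|H p pG].
  apply/negP => /H/negP; apply; by rewrite subUset !sub1set xI yI.
apply/negP => sp; have /eqP/cards2P[x [y [xy Ep]]] := edges_card pG.
move: sp; rewrite Ep subUset !sub1set => /andP[xI yI].
by have /negP := H x y xI yI; apply; rewrite /adj -Ep.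
Qed.

Lemma indep_number_ge G I : indep (adj G) I -> #|I| <= indep_number G.
Proof. by rewrite -indepE => iI; rewrite /indep_number (bigop.bigmax_sup I). Qed.

Lemma is_freeP t G : reflect (forall T, clique (adj G) T -> #|T| <> t) (is_free (complete t) G).
Proof.
apply: (iffP negP) => [nocopy T /cliqueP cT ET|noT].
  apply: nocopy; apply/existsP; subst t.
  exists [ffun i => enum_val i]; apply/andP; split.
    by apply/injectiveP => i j; rewrite !ffunE => /enum_val_inj.
  apply/forall_inP => p; rewrite inE => /cards2P[i [j [ij ->]]].
  rewrite imsetU !imset_set1 !ffunE; apply: cT; rewrite ?enum_valP //.
  by rewrite (inj_eq enum_val_inj).
move=> /existsP[f /andP[/injectiveP f_inj /forall_inP Hf]].
apply: (noT (f @: [set: 'I_t])%SET); last by rewrite card_imset // cardsT card_ord.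
apply/cliqueP => _ _ /imsetP[i _ ->] /imsetP[j _ ->] fij.
have : [set i; j]%SET \in edges (complete t).
  by rewrite inE cards2; have -> : i != j by apply: contraNneq fij => ->.
by move=> /Hf; rewrite imsetU !imset_set1.
Qed.

Lemma two_num_edges G : ecount (adj G) [set: V]%SET [set: V]%SET = 2 * num_edges G.
Proof.
rewrite /num_edges mulnC -sum_nat_const.
rewrite /ecount (eq_bigr (fun x => \sum_(y | adj G x y) 1)); last first.
  by move=> x _; rewrite sum1_card; apply: eq_card => y; rewrite !inE.
rewrite (eq_bigl predT); last by move=> x; rewrite inE.
rewrite pair_big_dep /=.
rewrite (partition_big (fun u : V * V => [set u.1; u.2]%SET) (mem (edges G))) /=; last first.
  by move=> [x y].
(* Ordered pairs are grouped by the edge they span, two to each edge. *)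
apply: eq_bigr => p pG; have /eqP/cards2P[x [y [xy Ep]]] := edges_card pG.
rewrite sum1_card.
rewrite (_ : #|_| = #|[set (x, y); (y, x)]%SET|); last first.
  apply: eq_card => -[u v]; rewrite !inE unfold_in /= Ep.
  apply/andP/orP => [[_ /eqP Euv]|[/eqP[-> ->]|/eqP[-> ->]]].
  - have := congr1 (fun S : {set V} => u \in S) Euv.
    have := congr1 (fun S : {set V} => v \in S) Euv.
    have := congr1 (fun S : {set V} => x \in S) Euv.
    have := congr1 (fun S : {set V} => y \in S) Euv.
    rewrite !inE !eqxx !orbT /= => hy hx hv hu.
    move: hx hy; case/esym/orP: hu => /eqP->; case/esym/orP: hv => /eqP->.
    + by rewrite orbb eq_sym (negbTE xy).
    + by left.
    + by right.
    + by rewrite orbb (negbTE xy).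
  - by rewrite /adj -Ep pG.
  - by rewrite /adj setUC -Ep pG.
by rewrite cards2 xpair_eqE (negbTE xy).
Qed.

Lemma graph_of_rel_subproof (e : rel V) :
  [forall p in [set p : {set V} | (#|p| == 2) &&
     [exists x, exists y, (p == [set x; y]%SET) && e x y]]%SET, #|p| == 2].
Proof. by apply/forall_inP => p; rewrite inE => /andP[]. Qed.

Definition graph_of_rel (e : rel V) : sgraph V :=
  exist (fun E : {set {set V}} => [forall p in E, #|p| == 2]) _ (graph_of_rel_subproof e).

Lemma adj_graph_of_rel (e : rel V) : symmetric e -> irreflexive e ->
  forall x y, adj (graph_of_rel e) x y = e x y.
Proof.
move=> e_sym e_irr x y; rewrite /adj inE cards2.
apply/andP/idP => [[xy /existsP[u /existsP[v /andP[/eqP E euv]]]]|exy].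
  have : x \in [set u; v]%SET by rewrite -E !inE eqxx.
  have : y \in [set u; v]%SET by rewrite -E !inE eqxx orbT.
  move: xy; rewrite !inE; case: eqVneq => // xy _.
  by move=> /orP[/eqP Ey|/eqP Ey] /orP[/eqP Ex|/eqP Ex]; move: xy; rewrite Ex Ey ?eqxx // e_sym.
have xy : x != y by apply: contraTneq exy => ->; rewrite e_irr.
by rewrite xy; split=> //; apply/existsP; exists x; apply/existsP; exists y; rewrite eqxx.
Qed.

End Bridge.

Lemma inv_ramsey_le (t n b : nat) (e : rel 'I_n) : symmetric e -> irreflexive e ->
  (forall T, clique e T -> #|T| <> t) -> (forall I, indep e I -> (#|I| <= b)%N) ->
  (inv_ramsey t n <= b)%N.
Proof.
move=> e_sym e_irr noT indI; pose G := graph_of_rel e.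
have aG := adj_graph_of_rel e_sym e_irr.
have cE T : clique (adj G) T = clique e T.
  by apply/cliqueP/cliqueP => H x y xT yT xy; have := H x y xT yT xy; rewrite aG.
have iE I : indep (adj G) I = indep e I.
  by apply/indepP/indepP => H x y xT yT; have := H x y xT yT; rewrite aG.
have freeG : is_free (complete t) G by apply/is_freeP => T; rewrite cE; exact: noT.
apply: leq_trans (_ : indep_number G <= _)%N; last first.
  by apply/bigop.bigmax_leqP => I; rewrite indepE iE; exact: indI.
(* [inv_ramsey] folds [minn] from the default [n]: the bound holds once [G] is met and survives
   every further [minn]. *)
rewrite /inv_ramsey; have : G \in index_enum _ by rewrite mem_index_enum.
elim: (index_enum _) => // G1 r IH; rewrite inE big_cons => /orP[/eqP<-|/IH le_r].
  by rewrite freeG geq_minl.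
by case: ifP => // _; rewrite geq_min le_r orbT.
Qed.

Lemma edge_bound (R : realType) (gamma : R) : 0 < gamma ->
  exists2 delta : R, 0 < delta & exists N : nat, forall n, (N <= n)%N ->
  forall G : sgraph 'I_n, is_free (complete 13) G ->
    (indep_number G)%:R <= delta * (inv_ramsey 5 n)%:R ->
    (num_edges G)%:R <= (4 / 15 + gamma) * n%:R ^+ 2.
Proof.
move=> gamma0; pose g := Num.min gamma (1 / 25).
have g01 : 0 < g <= 1 / 25 by rewrite lt_min gamma0 ge_min lexx orbT divr_gt0.
have g_le : g <= gamma by rewrite ge_min lexx.
have [C HC] := sparse_K5_free_graph.
have [j [N H]] := dense_graph_clique C g01.
have d0 : 0 < (j%:R + 1)^-1 :> R by rewrite invr_gt0 ltr_wpDl.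
(* This gives [a <= Q], which transfers the bound of order [n ^ (9/20)] to [a], and
   [(j + 1) * a <= Q], which contradicts [Q <= j * a] since [a] is positive. *)
exists (j%:R + 1)^-1; first by [].
exists (maxn N 1) => n; rewrite geq_max => /andP[leN n0] G freeG smallG.
rewrite leNgt; apply/negP => manyG.
have [e1 [b [e1_sym e1_irr e1K e1I hb]]] := HC n n0.
set a := indep_number G in smallG.
set Q := inv_ramsey 5 n in smallG.
have Qb : (Q <= b)%N by exact: inv_ramsey_le e1K e1I.
have aQ : (a <= Q)%N.
  rewrite -(ler_nat R); apply: le_trans smallG _; rewrite ler_piMl //.
  by rewrite invf_le1 ?lerDr // ltr_wpDl.
have a0 : (0 < a)%N.
  apply: leq_trans (indep_number_ge (G := G) (I := [set Ordinal n0]%SET) _).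
    by rewrite cards1.
  by apply/indepP => x y; rewrite !inE => /eqP-> /eqP->; rewrite adj_irr.
have [||||T T13 cT] := H n (adj G) a leN (adj_sym G) (adj_irr G).
- by apply: leq_trans hb; rewrite leq_exp2r // (leq_trans aQ).
- by move=> I; exact: indep_number_ge.
- move=> W cW.
  have [/existsP[T /and3P[sT /eqP ET cT]]|none] := boolP [exists T : {set 'I_n},
      [&& T \subset W, #|T| == 5 & clique (adj G) T]]; first by exists T.
  exfalso; have [||e2 [e2_sym e2_irr e2K e2I]] :=
    disjoint_copies (a := a) (t := 5) (adj_sym G) (adj_irr G) _ _ cW.
  + by move=> I _; exact: indep_number_ge.
  + move=> T sT cT ET; move: none; apply/negP/negPn/existsP.
    by exists T; rewrite sT cT ET eqxx.
  have Qa : (Q <= j * a)%N := inv_ramsey_le e2_sym e2_irr e2K e2I.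
  have j1 : 0 < j%:R + 1 :> R by rewrite ltr_wpDl.
  move: smallG; rewrite mulrC ler_pdivlMr //.
  move: Qa; rewrite -(ler_nat R) natrM => Qa.
  have : 0 < a%:R :> R by rewrite ltr0n.
  by move: Qa; lra.
- rewrite two_num_edges natrM; move: manyG => /ltW manyG.
  have h : (4 / 15 + g) * n%:R ^+ 2 <= (4 / 15 + gamma) * n%:R ^+ 2.
    by rewrite ler_wpM2r ?exprn_ge0 // lerD2l.
  by move: (le_trans h manyG); lra.
(* The clique may have more than 13 vertices, while freeness concerns exactly 13. *)
have [f f_inj fT] := injection_into_set T13.
have /is_freeP/(_ (f @: [set: 'I_13])%SET) := freeG.
apply; last by rewrite card_imset // cardsT card_ord.
apply/cliqueP => _ _ /imsetP[x _ ->] /imsetP[y _ ->].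
exact: (cliqueP _ _ cT).
Qed.

(** * Limits superior and the limit in [delta] *)

Local Open Scope classical_set_scope.

Lemma le_limn_esup (R : realType) (u v : nat -> \bar R) :
  (forall n, (u n <= v n)%E) -> (limn_esup u <= limn_esup v)%E.
Proof.
move=> le_uv; rewrite /limn_esup /limf_esup; apply: le_ereal_inf_tmp => _ [A Aoo <-].
apply: ge_ereal_inf; exists (ereal_sup (u @` A)); first by exists A.
apply: ge_ereal_sup => _ [n An <-]; apply: le_ereal_sup_tmp.
by exists (v n) => //; exists n.
Qed.

Lemma limn_esup_le_eventually (R : realType) (u : nat -> \bar R) (c : \bar R) (N : nat) :
  (forall n, (N <= n)%N -> (u n <= c)%E) -> (limn_esup u <= c)%E.
Proof.
move=> le_uc; rewrite /limn_esup /limf_esup; apply: ge_ereal_inf.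
exists (ereal_sup (u @` [set n | (N <= n)%N])).
  by exists [set n | (N <= n)%N] => //; exists N.
by apply: ge_ereal_sup => _ [n Nn <-]; exact: le_uc.
Qed.

Lemma RT_le (R : realType) (W : finType) (H : sgraph W) (n : nat) (a x : R) : 0 <= x ->
  (forall G : sgraph 'I_n, is_free H G -> (indep_number G)%:R <= a -> (num_edges G)%:R <= x) ->
  (RT H n a)%:R <= x.
Proof.
move=> x0 Hx; rewrite /RT; apply: (big_ind (fun k : nat => k%:R <= x)) => //.
- by move=> k1 k2 h1 h2; rewrite /maxn; case: ifP.
- by move=> G /andP[]; exact: Hx.
Qed.

Lemma RT_homo (R : realType) (W : finType) (H : sgraph W) (n : nat) (a b : R) :
  a <= b -> (RT H n a <= RT H n b)%N.
Proof.
move=> ab; apply/bigop.bigmax_leqP => G /andP[fG iG].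
by rewrite /RT (bigop.bigmax_sup G) // fG (le_trans iG).
Qed.

(** The upper density is nondecreasing in [delta], so its limit at 0 from the right exists and is
    the infimum over positive [delta]; a single [delta] for each [gamma] then bounds it. *)
Lemma rho_tau_o_leP (R : realType) (W : finType) (H : sgraph W) (f : nat -> R) (c : R) :
  (forall n, 0 <= f n) -> 0 <= c ->
  (forall gamma : R, 0 < gamma -> exists2 delta : R, 0 < delta & exists N : nat,
    forall n, (N <= n)%N -> forall G : sgraph 'I_n, is_free H G ->
    (indep_number G)%:R <= delta * f n -> (num_edges G)%:R <= (c + gamma) * n%:R ^+ 2) ->
  rho_tau_o_le H f c.
Proof.
move=> f0 c0 Hc; pose F (delta : R) := upper_rho_tau H (fun n => delta * f n).
exists (ereal_inf (F @` [set` Interval (BRight 0) +oo%O])).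
  apply: nondecreasing_at_right_cvge => // d1 d2 _ _ d12.
  apply: le_limn_esup => n; rewrite lee_fin ler_wpM2r ?invr_ge0 ?exprn_ge0 //.
  by rewrite ler_nat RT_homo // ler_wpM2r.
apply/lee_addgt0Pr => gamma gamma0; have [delta delta0 [N HN]] := Hc gamma gamma0.
apply: ge_ereal_inf; exists (F delta).
  by exists delta => //=; rewrite in_itv /= delta0.
(* The maximum with 1 keeps [n ^ 2] positive for the division. *)
apply: (@limn_esup_le_eventually _ _ _ (maxn N 1)) => n; rewrite geq_max => /andP[Nn n0].
rewrite -EFinD lee_fin ler_pdivrMr ?exprn_gt0 ?ltr0n //.
apply: RT_le => [|G fG iG]; last exact: HN.
by rewrite mulr_ge0 ?exprn_ge0 // addr_ge0 // ltW.
Qed.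

Theorem theorem1p6 (R : realType) :
  rho_tau_o_le (complete 13) (fun n : nat => (inv_ramsey 5 n)%:R : R) (4 / 15)
  /\
  (forall gamma : R, 0 < gamma ->
     exists2 delta : R, 0 < delta &
       \forall n \near \oo, forall G : sgraph 'I_n,
         is_free (complete 13) G ->
         (indep_number G)%:R <= delta * (inv_ramsey 5 n)%:R ->
         (num_edges G)%:R <= (4 / 15 + gamma) * n%:R ^+ 2).
Proof.
split; first by apply: rho_tau_o_leP => // gamma; exact: edge_bound.
move=> gamma /edge_bound[delta delta0 [N HN]]; exists delta => //.
by exists N => // n /= Nn; exact: HN.
Qed.
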